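(* For integers $0\le r<m<n$, define the substitutions $\tau_{m,n,r}:\{0,1\}\to\{0,1\}^*$ by $$\tau_{m,n,0}:\ 0\mapsto 0^{m-1}1,\quad 1\mapsto 0^{n-m}0^{m-1}1,$$ $$\tau_{m,n,r}:\ 0\mapsto 0^{m-1}10^{r-1}1,\quad 1\mapsto 0^{n-m}0^{m-1}10^{r-1}1\qquad\text{when } r>0.$$ Let $X$ be an infinite minimal subshift with $\limsup_{q\to\infty} p(q)/q<1.5$. Then there exist integers $0\le r_k<m_k<n_k$ ($k\ge0$), a finite alphabet $\mathcal{A}$ and a substitution $\pi:\{0,1\}\to\mathcal{A}^*$ such that $X$ is the orbit closure of $$\lim_{k\to\infty}\ \pi\circ\tau_{m_0,n_0,r_0}\circ\cdots\circ\tau_{m_k,n_k,r_k}(0).$$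
   Context: A subshift is a closed shift-invariant subset $X\subset\mathcal{A}^{\mathbb{Z}}$ ($\mathcal{A}$ finite); $p(q)$ is the number of words of length $q$ appearing in points of $X$. $\mathcal{A}^*$ is the set of nonempty finite words over $\mathcal{A}$. A substitution $\tau:\mathcal{A}\to\mathcal{B}^*$ is extended to words by concatenation, and substitutions are composed accordingly; $0^j$ denotes the word of $j$ zeros ($0^0$ is empty). The limit is a one-sided infinite sequence extending the words in question, and the orbit closure of a one-sided sequence means (via natural extension) the set of bi-infinite sequences all of whose finite subwords occur in it; thus the conclusion says that $X$ is the set of all $x\in\mathcal{A}^{\mathbb{Z}}$ each of whose finite subwords occurs in one of the words $\pi\circ\tau_{m_0,n_0,r_0}\circ\cdots\circ\tau_{m_k,n_k,r_k}(0)$. *)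

(* Defs.v *)
From mathcomp Require Import all_boot all_order all_algebra.
From mathcomp Require Import all_classical all_reals all_analysis.

Set Implicit Arguments.
Unset Strict Implicit.
Unset Printing Implicit Defensive.

Local Open Scope classical_set_scope.

(* Bi-infinite sequences over A, with the product of discrete topologies. *)
Definition biseq (A : finType) := prod_topology (fun _ : int => discrete_topology A).

Definition shift (A : finType) (x : biseq A) : biseq A :=
  fun i => x (i + 1)%R.

Definition subshift (A : finType) (X : set (biseq A)) : Prop :=
  closed X /\ @shift A @` X = X.

Definition minimal_subshift (A : finType) (X : set (biseq A)) : Prop :=
  [/\ subshift X, X !=set0 &
      forall Y : set (biseq A), subshift Y -> Y !=set0 -> Y `<=` X -> Y = X].

Definition occurs (A : finType) (w : seq A) (x : biseq A) : Prop :=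
  exists i : int, w = [seq x (i + j%:Z)%R | j <- iota 0 (size w)].

Definition complexity (A : finType) (X : set (biseq A)) (q : nat) : nat :=
  #|[set w : q.-tuple A | `[< exists2 x, X x & occurs w x >]]%SET|.

(* A substitution A -> B^* also has to take nonempty values; see [nonerasing]. *)
Definition substitution (A B : Type) := A -> seq B.

Definition nonerasing (A B : Type) (s : substitution A B) : Prop :=
  forall a, s a <> [::].

Definition subst_ext (A B : Type) (s : substitution A B) (w : seq A) : seq B :=
  flatten (map s w).

Definition subst_comp (A B C : Type)
    (s : substitution B C) (t : substitution A B) : substitution A C :=
  fun a => subst_ext s (t a).

(* The letters 0 and 1 are [false] and [true]. *)
Definition tau (m n r : nat) : substitution bool bool := fun a =>
  match r, a with
  | 0, false => nseq (m - 1) false ++ [:: true]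
  | 0, true => nseq (n - m) false ++ nseq (m - 1) false ++ [:: true]
  | _.+1, false =>
      nseq (m - 1) false ++ [:: true] ++ nseq (r - 1) false ++ [:: true]
  | _.+1, true =>
      nseq (n - m) false ++ nseq (m - 1) false ++ [:: true]
        ++ nseq (r - 1) false ++ [:: true]
  end.

(* tau_{m_0,n_0,r_0} o ... o tau_{m_k,n_k,r_k} *)
Fixpoint tau_prod (m n r : nat -> nat) (k : nat) : substitution bool bool :=
  if k is k'.+1 then
    subst_comp (tau_prod m n r k') (tau (m k) (n k) (r k))
  else tau (m 0) (n 0) (r 0).

(* A left-infinite sequence ... y_2 y_1 y_0 is encoded as y : nat -> A, with
   y 0 its last letter.  Since tau_{m,n,r}(0) is a suffix of tau_{m,n,r}(1) and
   both end in 1, each word pi o tau_0 o ... o tau_k (0) is a suffix of the next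
   one; it need not be a prefix of it (when m_k = 1, tau_k(0) may begin with 1
   and tau_k(1) with 0).  So the limit of these words is left-infinite, and the
   words occurring in it are those occurring in some pi o tau_0 o ... o tau_k (0). *)
Definition left_limit (A : finType) (w : nat -> seq A) (y : nat -> A) : Prop :=
  forall i, \forall k \near \oo, onth (rev (w k)) i = Some (y i).

Definition left_occurs (A : finType) (w : seq A) (y : nat -> A) : Prop :=
  exists i : nat, rev w = [seq y (i + j) | j <- iota 0 (size w)].

Definition left_orbit_closure (A : finType) (y : nat -> A) : set (biseq A) :=
  [set x | forall w, occurs w x -> left_occurs w y].

(* Main.v *)
(** Write p for the word complexity.  Since p(q) < 1.5 q, infinitely
many lengths q have p(q+1) = p(q) + 1, and then the Rauzy graph of order q
consists of two loops through a bispecial word W: every point of X is a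
concatenation of the two first-return words u and v of W, with
|u| + |v| = p(q) + 1 > q.

Code u, v by 0, 1 and look at the two-letter words occurring in the coding.
If 11 is missing, regroup by alpha: 0 -> 0, 1 -> 01; if 00 is missing, regroup
by gamma_2: 0 -> 1, 1 -> 01.  If both occur, W u and W v are right special, so
p grows by at least 2 at each step until one of the two branches dies.  Because
|u| + |v| > q and p(q) < 1.5 q, this must happen before length q + |u| + |v|,
and only two configurations survive: either the gaps between consecutive 1s
take exactly two values 0 and n - 1, and one regroups by
gamma_n: 0 -> 1, 1 -> 0^(n-1) 1; or every run of 1s has length two, and one
regroups by delta: 0 -> 0, 1 -> 011.  The same count shows that delta is not
followed by another delta before the next gamma.  Hence the composition is cut
into blocks alpha^k gamma_n and alpha^k delta alpha^j gamma_n, which are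
exactly the substitutions tau_{m,n,r} with r = 0 and r > 0. *)

Require Import Defs.
From mathcomp Require Import all_boot all_order all_algebra.
From mathcomp Require Import all_classical all_reals all_analysis.
From mathcomp Require Import zify.
Set Implicit Arguments.
Unset Strict Implicit.
Unset Printing Implicit Defensive.

(** * Languages and complexity *)

Definition pow (T : Type) (z : seq T) (j : nat) : seq T := flatten (nseq j z).

(** Defined for any predicate on words; for [lang X] it is convertible with [complexity X]. *)
Definition cplx (A : finType) (L : seq A -> Prop) (q : nat) : nat :=
  #|[set w : q.-tuple A | `[< L w >]]%SET|.

(** What is retained of an infinite minimal subshift: [lang_aper] excludes periodicity and
    [lang_recur] is uniform recurrence. The axioms are stable under reversal. *)
Record language (A : finType) (L : seq A -> Prop) : Prop := Language {
  lang_nil : L [::];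
  lang_infix : forall s t, infix s t -> L t -> L s;
  lang_rcons : forall w, L w -> exists a, L (rcons w a);
  lang_cons : forall w, L w -> exists a, L (a :: w);
  lang_aper : forall z, z != [::] -> exists j, ~ L (pow z j);
  lang_recur : forall w, L w ->
    exists N, forall t, L t -> N <= size t -> infix w t }.

Definition rspecial (A : finType) (L : seq A -> Prop) (z : seq A) : Prop :=
  exists a b, [/\ a != b, L (rcons z a) & L (rcons z b)].

Definition lspecial (A : finType) (L : seq A -> Prop) (z : seq A) : Prop :=
  exists a b, [/\ a != b, L (a :: z) & L (b :: z)].

Lemma pow0 T (z : seq T) : pow z 0 = [::]. Proof. by []. Qed.

Lemma powS T (z : seq T) j : pow z j.+1 = z ++ pow z j. Proof. by []. Qed.

Lemma powD T (z : seq T) i j : pow z (i + j) = pow z i ++ pow z j.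
Proof. by rewrite /pow nseqD flatten_cat. Qed.

Lemma powSr T (z : seq T) j : pow z j.+1 = pow z j ++ z.
Proof. by rewrite -addn1 powD /= powS pow0 cats0. Qed.

Lemma size_pow T (z : seq T) j : size (pow z j) = j * size z.
Proof. by elim: j => // j IH; rewrite powS size_cat IH mulSn. Qed.

Lemma rev_pow (T : eqType) (z : seq T) j : rev (pow z j) = pow (rev z) j.
Proof. by elim: j => // j IH; rewrite powS rev_cat IH powSr. Qed.

Section Counting.
Variables (A : finType) (L : seq A -> Prop).

Lemma cplx_enum q : exists T, [/\ uniq T,
  forall t : seq A, t \in T <-> L t /\ size t = q & size T = cplx L q].
Proof.
pose B := [set w : q.-tuple A | `[< L w >]]%SET.
exists [seq val t | t <- enum B]; split.
- by rewrite map_inj_uniq ?enum_uniq //; exact: val_inj.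
- move=> t; split.
    case/mapP => w; rewrite mem_enum inE => /asboolP Lw ->.
    by rewrite size_tuple.
  case=> Lt st; have st' : size t == q by rewrite st.
  apply/mapP; exists (Tuple st') => //.
  by rewrite mem_enum inE; apply/asboolP.
- by rewrite size_map -cardE.
Qed.

Lemma cplx_ge q (T : seq (seq A)) :
  uniq T -> (forall t : seq A, t \in T -> L t /\ size t = q) -> size T <= cplx L q.
Proof.
move=> uT TL; have [T' [uT' T'L <-]] := cplx_enum q.
by apply: uniq_leq_size => // t /TL /T'L.
Qed.

Lemma cplx_le q (T : seq (seq A)) :
  (forall t, L t -> size t = q -> t \in T) -> cplx L q <= size T.
Proof.
move=> TL; have [T' [uT' T'L <-]] := cplx_enum q.
by apply: uniq_leq_size => // t /T'L [Lt st]; apply: TL.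
Qed.

Hypothesis HL : language L.

Lemma lang_catl s t : L (s ++ t) -> L s.
Proof. by apply: (lang_infix HL); exact: prefix_infix. Qed.

Lemma lang_catr s t : L (s ++ t) -> L t.
Proof. by apply: (lang_infix HL); exact: suffix_infix. Qed.

Lemma lang_mid s t r : L (s ++ t ++ r) -> L t.
Proof. by move/lang_catr/lang_catl. Qed.

Lemma ext_fun : exists e : seq A -> A, forall w, L w -> L (rcons w (e w)).
Proof.
have [a _] := lang_rcons HL (lang_nil HL).
suff /choice[e He] : forall w, exists b, L w -> L (rcons w b) by exists e.
move=> w.
have [/(lang_rcons HL)[b Lb]|nL] := pselect (L w); first by exists b.
by exists a.
Qed.

(** Appending [e w] injects the words of length [q] into those of length [q.+1]; the pairs in [Z]
    give words outside the image, their last letter not being the chosen one. *)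
Lemma cplx_pairs q (e : seq A -> A) (Z : seq (seq A * A)) :
  (forall w, L w -> L (rcons w (e w))) -> uniq Z ->
  (forall z : seq A * A, z \in Z ->
    [/\ size z.1 = q, L (rcons z.1 z.2) & z.2 != e z.1]) ->
  cplx L q + size Z <= cplx L q.+1.
Proof.
move=> eL uZ HZ; have [T [uT TL <-]] := cplx_enum q.
pose T' := [seq rcons w (e w) | w <- T] ++ [seq rcons z.1 z.2 | z <- Z].
have -> : size T + size Z = size T' by rewrite size_cat !size_map.
apply: cplx_ge.
  rewrite cat_uniq; apply/and3P; split.
  - rewrite map_inj_in_uniq // => x y _ _ /eqP.
    by rewrite eqseq_rcons => /andP[/eqP].
  - apply/hasPn => t /mapP[z /HZ[_ _ ne] ->]; apply/negP => /mapP[w _ /eqP].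
    rewrite eqseq_rcons => /andP[/eqP E1 /eqP E2].
    by move: ne; rewrite E2 E1 eqxx.
  - rewrite map_inj_in_uniq // => -[x a] [y b] _ _ /= /eqP.
    by rewrite eqseq_rcons => /andP[/eqP -> /eqP ->].
move=> t; rewrite mem_cat => /orP[] /mapP[w].
  by move=> /TL[Lw sw] ->; rewrite size_rcons sw; split => //; exact: eL.
by move=> /HZ[sw Lw _] ->; rewrite size_rcons sw.
Qed.

(** Of two letters that can follow a right-special word, at least one differs from the letter chosen
    by [ext_fun]. *)
Lemma cplx_rspecial q (Z : seq (seq A)) :
  uniq Z -> (forall z : seq A, z \in Z -> rspecial L z /\ size z = q) ->
  cplx L q + size Z <= cplx L q.+1.
Proof.
move=> uZ HZ; have [e eL] := ext_fun.
have [a0 _] := lang_rcons HL (lang_nil HL).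
have [f Hf] : exists f : seq A -> A,
    forall z : seq A, z \in Z -> L (rcons z (f z)) /\ f z != e z.
  suff /choice[f Hf] : forall z, exists b,
      z \in Z -> L (rcons z b) /\ b != e z by exists f.
  move=> z.
  case: (boolP (z \in Z)) => [/HZ[[a [b [ab La Lb]]] _]|_]; last by exists a0.
  have [E|ne] := eqVneq a (e z); last by exists a.
  by exists b => _; split => //; rewrite -E eq_sym.
rewrite -(size_map (fun z => (z, f z)) Z); apply: (cplx_pairs eL).
  by rewrite map_inj_uniq // => x y [].
by move=> _ /mapP[z zZ ->] /=; have [_ sz] := HZ z zZ; have [] := Hf z zZ.
Qed.

Lemma rspecial_catr s t : rspecial L (s ++ t) -> rspecial L t.
Proof.
case=> a [b [ab]]; rewrite !rcons_cat => /lang_catr La /lang_catr Lb.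
by exists a, b.
Qed.

Lemma rspecial_suffix s t : suffix t s -> rspecial L s -> rspecial L t.
Proof. by case/suffixP => r ->; exact: rspecial_catr. Qed.

Lemma rspecial_L z : rspecial L z -> L z.
Proof. by case=> a [b [_]]; rewrite -cats1 => /lang_catl. Qed.

Lemma lang_catl_ext w n : L w -> exists2 y, size y = n & L (y ++ w).
Proof.
move=> Lw; elim: n => [|n [y <- Ly]]; first by exists [::].
by have [a La] := lang_cons HL Ly; exists (a :: y).
Qed.

Lemma lang_catr_ext w n : L w -> exists2 y, size y = n & L (w ++ y).
Proof.
move=> Lw; elim: n => [|n [y <- Ly]]; first by exists [::]; rewrite ?cats0.
have [a La] := lang_rcons HL Ly; exists (rcons y a); first by rewrite size_rcons.
by rewrite -rcons_cat.
Qed.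

Lemma lang_size_ex n : exists2 w, size w = n & L w.
Proof.
by have [y sy Ly] := lang_catr_ext n (lang_nil HL); exists y.
Qed.

Lemma no_pow_growth w0 z : z != [::] -> L w0 ->
  (forall j, L (w0 ++ pow z j) -> L (w0 ++ pow z j.+1)) -> False.
Proof.
move=> z0 L0 H; have [j []] := lang_aper HL z0.
have /lang_catr // : L (w0 ++ pow z j).
by elim: j => [|j /H //]; rewrite pow0 cats0.
Qed.

(** Without right-special words of length [q], a word of that length determines all that follows it.
    As it recurs, its continuation is periodic, against [lang_aper]. *)
Lemma rspecial_ex q : exists2 z, size z = q & rspecial L z.
Proof.
apply: contrapT => nr.
have det w x y : size w = q -> L (w ++ x) -> L (w ++ y) -> size x = size y ->
    x = y.
  elim/last_ind: x y => [|x a IH] y sw; first by case: y.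
  elim/last_ind: y => [|y b _]; first by rewrite size_rcons.
  rewrite !size_rcons -!rcons_cat => La Lb [sxy].
  have E : x = y.
    apply: IH => //.
      by move: La; rewrite -cats1 => /lang_catl.
    by move: Lb; rewrite -cats1 => /lang_catl.
  subst y; congr rcons; apply/eqP; apply: contrapT => /negP ab; apply: nr.
  exists (drop (size x) (w ++ x)); first by rewrite size_drop size_cat; lia.
  apply: (@rspecial_catr (take (size x) (w ++ x))); rewrite cat_take_drop.
  by exists a, b.
have [w sw Lw] := lang_size_ex q; have [N HN] := lang_recur HL Lw.
have [t st Lwt] := lang_catr_ext N.+1 Lw.
case: t st Lwt => // c t [st] Lwt.
have /HN : L t by apply: (@lang_catr (rcons w c)); rewrite cat_rcons.
case/(_ _)/infixP => [|p [s Et]]; first by rewrite st.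
(* [B] runs from the end of one occurrence of [w] to the end of a later one, so [w ++ B] ends in [w]
   and [B] must repeat for ever. *)
pose B := drop q (w ++ c :: p ++ w).
have wB : w ++ B = w ++ c :: p ++ w by rewrite /B drop_size_cat // ?sw.
have wB' : w ++ B = (w ++ c :: p) ++ w by rewrite wB -catA.
have B0 : B != [::] by rewrite /B drop_size_cat // ?sw.
have sp : size B = size (w ++ c :: p).
  by have := congr1 size wB'; rewrite !size_cat; lia.
apply: (@no_pow_growth w B) => // j Lj.
have [y sy Ly] := lang_catr_ext (size B) Lj.
have Ew i : exists r, w ++ pow B i = r ++ w.
  elim: i => [|i [r IH]]; first by exists [::]; rewrite pow0 cats0.
  by exists (r ++ (w ++ c :: p)); rewrite powSr catA IH -[RHS]catA -wB' -catA.
have [r Er] := Ew j; rewrite powSr catA Er -catA.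
have -> : B = y.
  apply: (det w) => //.
  - rewrite wB; apply: (@lang_catl _ s); move: Lwt; rewrite Et.
    by rewrite -!catA /= -!catA.
  - by apply: (@lang_catr r); rewrite catA -Er.
by rewrite catA -Er.
Qed.

Lemma cplx_lt q : cplx L q < cplx L q.+1.
Proof.
have [z sz rz] := rspecial_ex q.
rewrite -addn1; apply: (@cplx_rspecial q [:: z]) => // t.
by rewrite inE => /eqP ->.
Qed.

(** The Morse-Hedlund bound. *)
Lemma cplx_gt q : q < cplx L q.
Proof.
elim: q => [|q IH]; last exact: leq_ltn_trans (cplx_lt q).
apply: (@cplx_ge 0 [:: [::]]) => // t; rewrite inE => /eqP ->.
by split => //; exact: lang_nil.
Qed.

Lemma cplx_addn q n : cplx L q + n <= cplx L (q + n).
Proof.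
elim: n => [|n IH]; first by rewrite !addn0.
by have := cplx_lt (q + n); rewrite !addnS; lia.
Qed.

End Counting.

(** * Reversal of words, exchanging left-special and right-special *)

Section Reversal.
Variables (A : finType) (L : seq A -> Prop).

Lemma rev_language : language L -> language (L \o rev).
Proof.
move=> HL; split => /=.
- exact: lang_nil.
- move=> s t ist; apply: (lang_infix HL); by rewrite infix_rev.
- by move=> w /(lang_cons HL)[a La]; exists a; rewrite rev_rcons.
- by move=> w /(lang_rcons HL)[a La]; exists a; rewrite rev_cons.
- move=> z z0; have [|j nL] := @lang_aper _ _ HL (rev z).
    by rewrite -size_eq0 size_rev size_eq0.
  by exists j; rewrite rev_pow.
- move=> w /(lang_recur HL)[N HN]; exists N => t Lt st.
  by rewrite -infix_rev; apply: HN => //; rewrite size_rev.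
Qed.

Lemma cplx_rev q : cplx (L \o rev) q = cplx L q.
Proof.
have rinj : injective (@rev A) by exact: can_inj revK.
apply/eqP; rewrite eqn_leq; apply/andP; split.
  have [T [uT TL sT]] := cplx_enum L q.
  rewrite -sT -(size_map rev); apply: cplx_le => t /= Lt st.
  by rewrite -[t]revK mem_map //; apply/TL; rewrite size_rev.
have [T [uT TL sT]] := cplx_enum (L \o rev) q.
rewrite -sT -(size_map rev); apply: cplx_le => t /= Lt st.
by rewrite -[t]revK mem_map //; apply/TL; rewrite size_rev /= revK.
Qed.

Lemma rspecial_rev z : rspecial (L \o rev) (rev z) <-> lspecial L z.
Proof.
by split => -[a [b [ab /= La Lb]]]; exists a, b;
  move: La Lb; rewrite /= !rev_rcons !revK.
Qed.

Lemma lspecial_rev z : lspecial (L \o rev) (rev z) <-> rspecial L z.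
Proof.
by split => -[a [b [ab /= La Lb]]]; exists a, b;
  move: La Lb; rewrite /= !rev_cons !revK.
Qed.

End Reversal.

(** * Coding by two words *)

Section Substitutions.
Variables (A B : Type).

Lemma subst_ext_cons (s : substitution A B) a w :
  subst_ext s (a :: w) = s a ++ subst_ext s w.
Proof. by []. Qed.

Lemma subst_ext_cat (s : substitution A B) w t :
  subst_ext s (w ++ t) = subst_ext s w ++ subst_ext s t.
Proof. by rewrite /subst_ext map_cat flatten_cat. Qed.

Lemma subst_ext1 (s : substitution A B) a : subst_ext s [:: a] = s a.
Proof. by rewrite /subst_ext /= cats0. Qed.

Lemma subst_ext_rcons (s : substitution A B) w a :
  subst_ext s (rcons w a) = subst_ext s w ++ s a.
Proof. by rewrite -cats1 subst_ext_cat subst_ext1. Qed.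

Lemma subst_ext_pow (s : substitution A B) w j :
  subst_ext s (pow w j) = pow (subst_ext s w) j.
Proof. by elim: j => // j IH; rewrite !powS subst_ext_cat IH. Qed.

End Substitutions.

Lemma subst_ext_comp (A B C : Type)
    (s : substitution B C) (t : substitution A B) w :
  subst_ext (subst_comp s t) w = subst_ext s (subst_ext t w).
Proof.
by elim: w => // a w IH; rewrite !subst_ext_cons subst_ext_cat IH.
Qed.

Lemma pow1 (T : Type) (a : T) j : pow [:: a] j = nseq j a.
Proof. by elim: j => // j IH; rewrite powS IH. Qed.

(** [alpha k] is the [k]-th power of [alpha 1], and [alpha 0] is the identity. *)
Definition alpha (k : nat) : substitution bool bool := fun b =>
  if b then nseq k false ++ [:: true] else [:: false].

Definition gamma (n : nat) : substitution bool bool := fun b =>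
  if b then nseq n.-1 false ++ [:: true] else [:: true].

Definition delta : substitution bool bool := fun b =>
  if b then [:: false; true; true] else [:: false].

(* The word coded by [w], between the longest suffix [S] common to everything
   that can be coded on its left and the longest prefix [P] common to
   everything that can be coded on its right. *)
Definition frame (A : Type) (S P : seq A) (pi : substitution bool A)
  (w : seq bool) : seq A := S ++ subst_ext pi w ++ P.

(* [S ++ P] is the bispecial word W.  Uniqueness of the coding is never needed:
   only the words [frame S P pi w] of the language are considered, and they are
   required to extend on both sides. *)
Record coding (A : finType) (L : seq A -> Prop) (S P : seq A)
    (pi : substitution bool A) : Prop := Coding {
  cod_pre : exists2 p : bool -> A, p false != p true &
    forall b, prefix (rcons P (p b)) (pi b ++ P);
  cod_suf : exists2 s : bool -> A, s false != s true &
    forall b, suffix (s b :: S) (S ++ pi b);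
  cod_nil : L (S ++ P);
  cod_ext_r : forall w, L (frame S P pi w) ->
    exists b, L (frame S P pi (rcons w b));
  cod_ext_l : forall w, L (frame S P pi w) ->
    exists b, L (frame S P pi (b :: w)) }.

Section Coding.
Variables (A : finType) (L : seq A -> Prop) (HL : language L).
Variables (S P : seq A) (pi : substitution bool A) (HC : coding L S P pi).

Let F := frame S P pi.
(** This plays the role of the language of the binary coding sequences. *)
Let Y w := L (F w).

Lemma coding_nonerasing b : pi b != [::].
Proof.
have [p _ /(_ b)/size_prefix] := cod_pre HC.
by case: (pi b) => //=; rewrite size_rcons ltnn.
Qed.

Lemma coding_size_gt0 b : 0 < size (pi b).
Proof. by rewrite lt0n size_eq0 coding_nonerasing. Qed.

Lemma subst_ext_eq0 w : (subst_ext pi w == [::]) = (w == [::]).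
Proof.
case: w => // b w; rewrite -!size_eq0 subst_ext_cons size_cat /=.
by have := coding_size_gt0 b; case: size.
Qed.

Lemma suffix_subst_ext w : suffix S (S ++ subst_ext pi w).
Proof.
elim/last_ind: w => [|w b /suffixP[r IH]].
  by rewrite cats0 suffix_refl.
rewrite subst_ext_rcons catA IH -catA; apply: suffix_catr.
have [s _ /(_ b)] := cod_suf HC.
by apply: suffix_trans; exact: suffix_cons.
Qed.

Lemma prefix_subst_ext w : prefix P (subst_ext pi w ++ P).
Proof.
elim: w => [|b w /prefixP[r IH]] /=; first exact: prefix_refl.
rewrite subst_ext_cons -catA IH catA; apply: prefix_catl.
have [p _ /(_ b)] := cod_pre HC.
by apply: prefix_trans; exact: prefix_rcons.
Qed.

(** Whatever is coded on the left of [t] leaves [S] before it, and whatever is coded on the right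
    begins with [P] after it. *)
Lemma frame_infix w t r : infix (F t) (F (w ++ t ++ r)).
Proof.
rewrite /F /frame !subst_ext_cat.
have /suffixP[x E1] := suffix_subst_ext w.
have /prefixP[y E2] := prefix_subst_ext r.
apply/infixP; exists x, y.
by rewrite -!catA -E2 (catA S) E1 -!catA.
Qed.

Lemma coded_mid w t r : Y (w ++ t ++ r) -> Y t.
Proof. by apply: (lang_infix HL); exact: frame_infix. Qed.

Lemma coded_catl w t : Y (w ++ t) -> Y w.
Proof. exact: (@coded_mid [::]). Qed.

Lemma coded_catr w t : Y (w ++ t) -> Y t.
Proof. by have := @coded_mid w t [::]; rewrite cats0. Qed.

Lemma coded_nil : Y [::]. Proof. exact: cod_nil HC. Qed.

(** The letter just before the final [S ++ P] reveals the last coded letter; this is what separates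
    right-special branches. *)
Lemma frame_rcons_suffix : exists2 s : bool -> A, s false != s true &
  forall w b, suffix (s b :: S ++ P) (F (rcons w b)).
Proof.
have [s s01 Hs] := cod_suf HC; exists s => // w b.
rewrite /F /frame subst_ext_rcons.
have /suffixP[x E] := suffix_subst_ext w.
have /suffixP[y E'] := Hs b.
by apply/suffixP; exists (x ++ y); rewrite -!catA (catA S) E -!catA (catA S) E' -!catA.
Qed.

Lemma frame_suffix w : suffix (S ++ P) (F w).
Proof.
have /suffixP[x E] := suffix_subst_ext w.
by apply/suffixP; exists x; rewrite /F /frame catA E -catA.
Qed.

(** The letter after the common prefix [P] distinguishes the two possible next coded letters. *)
Lemma coded_rspecial w : Y (rcons w false) -> Y (rcons w true) -> rspecial L (F w).
Proof.
have [p p01 Hp] := cod_pre HC.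
have E b : Y (rcons w b) -> L (rcons (F w) (p b)).
  rewrite /Y /F /frame subst_ext_rcons -catA.
  have /prefixP[y ->] := Hp b.
  by rewrite !catA => /(lang_catl HL); rewrite !rcons_cat.
by move=> /E L0 /E L1; exists (p false), (p true).
Qed.

Lemma coded_no_growth w0 z : z != [::] -> Y w0 ->
  (forall j, Y (w0 ++ pow z j) -> Y (w0 ++ pow z j.+1)) -> False.
Proof.
move=> z0 Y0 H.
have [|j []] := @lang_aper _ _ HL (subst_ext pi z).
  by rewrite subst_ext_eq0.
have : Y (w0 ++ pow z j).
  by elim: j => [|j /H //]; rewrite pow0 cats0.
move/coded_catr; rewrite /Y /F /frame subst_ext_pow.
exact: (lang_mid HL).
Qed.

(** Otherwise a run of [~~ b] could be prolonged for ever, and all powers of one coded letter would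
    occur. *)
Lemma coded_ext_r b w : Y w -> exists j, Y (w ++ nseq j (~~ b) ++ [:: b]).
Proof.
move=> Yw; apply: contrapT => nj.
apply: (@coded_no_growth w [:: ~~ b]) => // j; rewrite !pow1 => Yj.
have [c] := cod_ext_r HC Yj.
have [->|] := eqVneq c b; rewrite -/(F _) -/(Y _) -cats1 -catA.
  by move=> Yb; case: nj; exists j.
move=> cb; have -> : c = ~~ b by case: c b cb {nj Yj} => -[].
by rewrite -(nseqD j 1) addn1.
Qed.

Lemma coded_ext_l b w : Y w -> exists j, Y (b :: nseq j (~~ b) ++ w).
Proof.
move=> Yw; apply: contrapT => nj.
have H j : Y (nseq j (~~ b) ++ w).
  elim: j => [//|j IH]; have [c] := cod_ext_l HC IH.
  rewrite -/(F _) -/(Y _); have [->|] := eqVneq c b.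
    by move=> Yb; case: nj; exists j.
  by case: c b {nj IH} => -[].
apply: (@coded_no_growth [::] [:: ~~ b]) => // [|j _]; first exact: coded_nil.
by rewrite pow1; apply: coded_catl (H j.+1).
Qed.

Lemma coded_max_run : exists B, Y (nseq B false) /\ ~ Y (nseq B.+1 false).
Proof.
apply: contrapT => nB.
apply: (@coded_no_growth [::] [:: false]) => // [|j]; first exact: coded_nil.
rewrite !pow1 /= => Yj; apply: contrapT => nY; apply: nB.
by exists j.
Qed.

Lemma coded_nseq_le i j : i <= j -> Y (nseq j false) -> Y (nseq i false).
Proof. by move=> /subnKC <-; rewrite nseqD => /coded_catl. Qed.

(** Both images under [alpha 1] begin with 0, so [P] lengthens to [pi false ++ P]; the final 0 on
    the right is the start of whichever block follows. *)
Lemma frame_alpha w :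
  frame S (pi false ++ P) (subst_comp pi (alpha 1)) w =
  F (rcons (subst_ext (alpha 1) w) false).
Proof. by rewrite /F /frame subst_ext_comp subst_ext_rcons -catA. Qed.

Lemma frame_delta w :
  frame S (pi false ++ P) (subst_comp pi delta) w =
  F (rcons (subst_ext delta w) false).
Proof. by rewrite /F /frame subst_ext_comp subst_ext_rcons -catA. Qed.

(** Here both images end in 1, so it is [S] that lengthens, by the end of whichever block
    precedes. *)
Lemma frame_gamma n w :
  frame (S ++ pi true) P (subst_comp pi (gamma n)) w =
  F (true :: subst_ext (gamma n) w).
Proof. by rewrite /F /frame subst_ext_comp subst_ext_cons -!catA. Qed.

(** Every 1 has a 0 on each side, so the extension properties pass to the blocks 0 and 01. *)
Lemma coding_alpha : ~ Y [:: true; true] ->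
  coding L S (pi false ++ P) (subst_comp pi (alpha 1)).
Proof.
move=> n11; split.
- have [p p01 Hp] := cod_pre HC; exists p => // -[];
    rewrite /subst_comp /subst_ext /= ?cats0 -?catA rcons_cat prefix_catr ?eqxx //=.
  have /prefixP[y E] := prefix_subst_ext [:: false].
  move: E; rewrite subst_ext1 => ->; rewrite catA; apply: prefix_catl.
  exact: Hp.
- have [s s01 Hs] := cod_suf HC; exists s => // -[];
    rewrite /subst_comp /subst_ext /= ?cats0 //.
  have /suffixP[x E] := suffix_subst_ext [:: false].
  by rewrite subst_ext1 in E; rewrite catA E -catA; apply: suffix_catr.
- have [j] := coded_ext_r false coded_nil.
  rewrite /= => /coded_catr; rewrite /Y /F /frame subst_ext1 //.
- move=> w; rewrite frame_alpha => Yw; have [[]] := cod_ext_r HC Yw => Yw'.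
    exists true; rewrite frame_alpha subst_ext_rcons.
    have [[]] := cod_ext_r HC Yw'.
      rewrite -!cats1 -!catA /= => /coded_catr/(@coded_catr [:: false]) //.
    by rewrite -!cats1 -!catA.
  by exists false; rewrite frame_alpha subst_ext_rcons cats1.
- move=> w; rewrite frame_alpha => Yw; have [[]] := cod_ext_l HC Yw => Yw'.
    exists true; rewrite frame_alpha subst_ext_cons.
    have [[]//] := cod_ext_l HC Yw'.
    by move=> /(@coded_catl [:: true; true]).
  by exists false; rewrite frame_alpha.
Qed.

(** The two exclusions force every run of 1s between zeros to be 11, so that the blocks 0 and 011
    suffice. *)
Lemma coding_delta : ~ Y [:: true; true; true] -> ~ Y [:: false; true; false] ->
  coding L S (pi false ++ P) (subst_comp pi delta).
Proof.
move=> n111 n010; split.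
- have [p p01 Hp] := cod_pre HC; exists p => // -[];
    rewrite /subst_comp /subst_ext /= ?cats0 -?catA rcons_cat prefix_catr ?eqxx //=.
  have /prefixP[y E] := prefix_subst_ext [:: true; false].
  move: E; rewrite !subst_ext_cons cats0 -catA => ->; rewrite catA.
  by apply: prefix_catl; exact: Hp.
- have [s s01 Hs] := cod_suf HC; exists s => // -[];
    rewrite /subst_comp /subst_ext /= ?cats0 //.
  have /suffixP[x E] := suffix_subst_ext [:: false; true].
  rewrite !subst_ext_cons cats0 in E.
  by rewrite !catA -(catA S) E -catA; apply: suffix_catr.
- have [j] := coded_ext_r false coded_nil.
  rewrite /= => /coded_catr; rewrite /Y /F /frame subst_ext1 //.
- move=> w; rewrite frame_delta => Yw; have [[]] := cod_ext_r HC Yw => Yw'.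
    exists true; rewrite frame_delta subst_ext_rcons.
    have [[]] := cod_ext_r HC Yw'; last first.
      by rewrite -!cats1 -!catA => /coded_catr.
    move=> Yw''; have [[]] := cod_ext_r HC Yw''.
      by rewrite -!cats1 -!catA => /coded_catr/(@coded_catr [:: false]).
    by rewrite -!cats1 -!catA.
  by exists false; rewrite frame_delta subst_ext_rcons cats1.
- move=> w; rewrite frame_delta => Yw; have [[]] := cod_ext_l HC Yw => Yw'.
    exists true; rewrite frame_delta subst_ext_cons.
    have [t Et] : exists t, rcons (subst_ext delta w) false = false :: t.
      by case: w {Yw Yw'} => [|[] w] /=; [exists [::] | eexists | eexists].
    rewrite Et in Yw' *; have [[]] := cod_ext_l HC Yw' => Yw''.
      have [[]] := cod_ext_l HC Yw'' => //.
        by move=> /(@coded_catl [:: true; true; true]).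
      by rewrite rcons_cat Et.
    by case: n010; apply: (@coded_catl _ t); exact: Yw''.
  by exists false; rewrite frame_delta.
Qed.

Lemma coding_gamma n : 1 < n ->
  (forall g, Y (true :: nseq g false ++ [:: true]) -> g = 0 \/ g = n.-1) ->
  coding L (S ++ pi true) P (subst_comp pi (gamma n)).
Proof.
move=> n1 gaps; have En : n.-1 = n.-2.+1 by lia.
split.
(* The letters are swapped by [negb]: [gamma n false] begins with 1, whereas [gamma n true] begins
   with 0 since [1 < n]. The same happens on the left, just before the final 1. *)
- have [p p01 Hp] := cod_pre HC; exists (p \o negb) => /= [|[]]; first by rewrite eq_sym.
    rewrite /subst_comp /gamma En subst_ext_cons -/(cat _ _) -catA.
    have /prefixP[y ->] := prefix_subst_ext (nseq n.-2 false ++ [:: true]).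
    by rewrite catA; apply: prefix_catl; exact: Hp.
  by rewrite /subst_comp /= subst_ext1; exact: Hp.
- have [s s01 Hs] := cod_suf HC; exists (s \o negb) => /= [|b]; first by rewrite eq_sym.
  have [w ->] : exists w, (S ++ pi true) ++ subst_comp pi (gamma n) b =
      S ++ subst_ext pi (rcons w (~~ b)) ++ pi true.
    case: b => /=.
      exists (true :: nseq n.-2 false).
      have -> : rcons (true :: nseq n.-2 false) (~~ true) = true :: nseq n.-1 false.
        by rewrite -cats1 /= -(nseqD n.-2 1) addn1 -En.
      by rewrite /subst_comp /gamma subst_ext_cat subst_ext1 subst_ext_cons -!catA.
    by exists [::]; rewrite /subst_comp /= !subst_ext1 -catA.
  rewrite subst_ext_rcons -catA catA.
  have /suffixP[x ->] := suffix_subst_ext w.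
  have /suffixP[y E] := Hs (~~ b).
  by apply/suffixP; exists (x ++ y); rewrite -!catA (catA S) E -!catA.
- have [j] := coded_ext_r true coded_nil.
  by rewrite /= => /coded_catr; rewrite /Y /F /frame subst_ext1 catA.
- move=> w; rewrite frame_gamma => Yw.
  have [j Yj] := coded_ext_r true Yw.
  have [t Et] : exists t, true :: subst_ext (gamma n) w = rcons t true.
    elim/last_ind: w {Yw Yj} => [|w b _]; first by exists [::].
    rewrite subst_ext_rcons; case: b;
      rewrite /= ?catA cats1 -rcons_cons; eexists; reflexivity.
  have [Ej|Ej] : j = 0 \/ j = n.-1.
  + by apply: gaps; apply: (@coded_catr t); move: Yj; rewrite Et -cats1 -!catA.
  + exists false; rewrite frame_gamma subst_ext_rcons.
    by move: Yj; rewrite Ej.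
  + exists true; rewrite frame_gamma subst_ext_rcons.
    by move: Yj; rewrite Ej.
- move=> w; rewrite frame_gamma => Yw.
  have [j Yj] := coded_ext_l true Yw.
  have [Ej|Ej] : j = 0 \/ j = n.-1.
  + apply: gaps; apply: (@coded_catl _ (subst_ext (gamma n) w)).
    by rewrite /= -catA.
  + by exists false; rewrite frame_gamma; move: Yj; rewrite Ej.
  + exists true; rewrite frame_gamma subst_ext_cons /= -catA.
    by move: Yj; rewrite Ej.
Qed.

End Coding.

(** * Counting right-special branches *)

Definition sfx (T : Type) (l : nat) (z : seq T) : seq T := drop (size z - l) z.

Lemma sfx_suffix (T : eqType) (t z : seq T) : suffix t z -> sfx (size t) z = t.
Proof. by rewrite suffixE => /eqP. Qed.

Lemma suffix_sfx (T : eqType) l (z : seq T) : suffix (sfx l z) z.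
Proof. exact: suffix_drop. Qed.

Lemma size_sfx (T : Type) l (z : seq T) : l <= size z -> size (sfx l z) = l.
Proof. by move=> lz; rewrite size_drop; lia. Qed.

Lemma sfx_sfx (T : Type) l m (z : seq T) : l <= m <= size z ->
  sfx l (sfx m z) = sfx l z.
Proof.
by move=> lmz; rewrite {1 3}/sfx /sfx drop_drop size_drop; congr drop; lia.
Qed.

Lemma nseqSr (T : Type) n (x : T) : nseq n.+1 x = rcons (nseq n x) x.
Proof. by rewrite -cats1 -(nseqD n 1) addn1. Qed.

(** Suffixes of right-special words are right special. At each length from [l] to [l + n - 1] every
    [z] in [Z] supplies one, and these are distinct because their last [k] letters already are. *)
Lemma cplx_branch (A : finType) (L : seq A -> Prop) (HL : language L) k l n
    (Z : seq (seq A)) :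
  k <= l -> uniq (map (sfx k) Z) ->
  (forall z : seq A, z \in Z -> rspecial L z /\ l + n <= (size z).+1) ->
  cplx L l + n * size Z <= cplx L (l + n).
Proof.
move=> kl uZ; elim: n => [|n IH] HZ; first by rewrite mul0n !addn0.
have {}IH : cplx L l + n * size Z <= cplx L (l + n).
  by apply: IH => z /HZ[rz]; split => //; lia.
rewrite addnS mulSn.
suff : cplx L (l + n) + size Z <= cplx L (l + n).+1 by lia.
have E (z : seq A) : z \in Z -> sfx k (sfx (l + n) z) = sfx k z.
  by move=> /HZ[_ sz]; rewrite sfx_sfx //; lia.
rewrite -(size_map (sfx (l + n)) Z); apply: (cplx_rspecial HL).
  apply: (@map_uniq _ _ (sfx k)); rewrite -map_comp.
  rewrite (_ : map _ Z = map (sfx k) Z) //; exact/eq_in_map.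
move=> _ /mapP[z /HZ[rz sz] ->]; split; last by rewrite size_sfx //; lia.
exact: (rspecial_suffix HL) (suffix_sfx _ _) rz.
Qed.

(* With q = |S ++ P|, the number [D] bounds the deficit of p(q) with respect to
   |pi 0| + |pi 1| - 1.  As long as it is positive, a right-special branch [Z]
   of an earlier level, which does not end in [S ++ P], survives up to length
   q + D - 1 and will fill the deficit.  The flag records that a delta has been
   used since the last gamma; its inequality forbids a second one. *)
Record state (A : finType) (L : seq A -> Prop) (fl : bool) (S P : seq A)
    (pi : substitution bool A) (D : nat) : Prop := State {
  st_cod : coding L S P pi;
  st_le : size (pi false) <= size (pi true);
  st_lt : size S + size P < size (pi false) + size (pi true);
  st_cplx : size (pi false) + size (pi true)
    <= cplx L (size S + size P) + D + 1;
  st_bound : forall l, size S + size P <= l -> 2 * cplx L l < 3 * l;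
  st_D : D <= size (pi true);
  st_pend : 0 < D ->
    3 * (size S + size P) + 2 + D <= 3 * size (pi false) + 2 * size (pi true)
    /\ exists Z, [/\ rspecial L Z, (size Z).+1 = size S + size P + D
         & ~~ suffix (S ++ P) Z];
  st_flag : fl ->
    3 * (size S + size P) + 3 <= 2 * size (pi false) + 3 * size (pi true) }.

(** * Transitions between states *)

Section State.
Variables (A : finType) (L : seq A -> Prop) (HL : language L).
Variables (fl : bool) (S P : seq A) (pi : substitution bool A) (D : nat).
Hypothesis HS : state L fl S P pi D.

Let F := frame S P pi.
Let Y w := L (F w).
Let HC := st_cod HS.
Let q := size S + size P.
Let a := size (pi false).
Let b := size (pi true).

Lemma size_frame w : size (F w) = q + size (subst_ext pi w).
Proof. by rewrite !size_cat /q; lia. Qed.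

Lemma size_frame1 c : size (F [:: c]) = q + size (pi c).
Proof. by rewrite size_frame subst_ext1. Qed.

Lemma frame_uniq2 w w' :
  uniq (map (sfx q.+1) [:: F (rcons w false); F (rcons w' true)]).
Proof.
have [s s01 Hs] := frame_rcons_suffix HC.
have E w0 c : sfx q.+1 (F (rcons w0 c)) = s c :: S ++ P.
  by rewrite -(sfx_suffix (Hs w0 c)) /= size_cat.
by rewrite /= !E inE eqseq_cons negb_and s01.
Qed.

Lemma frame_uniq3 Z w w' : ~~ suffix (S ++ P) Z ->
  uniq (map (sfx q.+1) [:: Z; F (rcons w false); F (rcons w' true)]).
Proof.
move=> nZ; have [s s01 Hs] := frame_rcons_suffix HC.
have E w0 c : sfx q.+1 (F (rcons w0 c)) = s c :: S ++ P.
  by rewrite -(sfx_suffix (Hs w0 c)) /= size_cat.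
have N c : sfx q.+1 Z != s c :: S ++ P.
  apply: contra nZ => /eqP EZ; apply: suffix_trans (suffix_sfx q.+1 Z).
  by rewrite EZ suffix_cons.
by rewrite /= !E !inE !eqseq_cons !negb_or !negb_and s01 !N.
Qed.

(** Length [q] already suffices against a branch that does not end in [S ++ P]; telling two frames
    apart takes one letter more. *)
Lemma frame_uniqZ Z w : ~~ suffix (S ++ P) Z ->
  uniq (map (sfx q) [:: Z; F w]).
Proof.
move=> nZ; rewrite /= andbT inE.
have := sfx_suffix (frame_suffix HC w); rewrite size_cat -/q -/F => ->.
apply: contra nZ => /eqP <-; exact: suffix_sfx.
Qed.

Lemma coded_letter c : Y [:: c].
Proof.
have [j Yj] := coded_ext_r HL HC c (coded_nil HC).
by apply: (@coded_catr _ _ HL _ _ _ HC (nseq j (~~ c))).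
Qed.

Lemma coded_alt c : Y [:: c; ~~ c].
Proof.
have [[|j] Yj] := coded_ext_l HL HC c (coded_letter (~~ c)) => //.
by apply: (@coded_catl _ _ HL _ _ _ HC _ (nseq j (~~ c) ++ [:: ~~ c])).
Qed.

Lemma coded_rcons2 r c d : Y (rcons (rcons r c) d) -> Y [:: c; d].
Proof. by rewrite -!cats1 -catA; exact: coded_catr. Qed.

Lemma coded_rcons3 r c d e : Y (rcons (rcons (rcons r c) d) e) -> Y [:: c; d; e].
Proof. by rewrite -!cats1 -!catA; exact: coded_catr. Qed.

(** If 00 were missing as well, 0 and 1 would alternate and the coding would be periodic. *)
Lemma coded_00 : ~ Y [:: true; true] -> Y [:: false; false].
Proof.
move=> n11; apply: contrapT => n00.
apply: (@coded_no_growth _ _ HL _ _ _ HC [:: false] [:: true; false]) => [//||j].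
  exact: coded_letter.
have [r Er] : exists r, [:: false] ++ pow [:: true; false] j = rcons r false.
  case: j => [|j]; first by exists [::].
  rewrite powSr; exists ([:: false] ++ pow [:: true; false] j ++ [:: true]).
  by rewrite -cats1 -!catA.
rewrite powSr catA Er => /(cod_ext_r HC)[[]]; last by move=> /coded_rcons2.
move=> /(cod_ext_r HC)[[]]; first by move=> /coded_rcons2.
by rewrite -!cats1 -!catA.
Qed.

(** The bispecial word grows by [a] letters. The branch [F [:: false]] adds one word per length, and
    the pending branch, while it lasts, adds another, which pays off [minn D a] of the deficit. *)
Lemma state_alpha : ~ Y [:: true; true] ->
  state L fl S (pi false ++ P) (subst_comp pi (alpha 1)) (D - a).
Proof.
move=> n11; have Y00 := coded_00 n11.
have Ea : size (subst_comp pi (alpha 1) false) = a.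
  by rewrite /subst_comp subst_ext1.
have Eb : size (subst_comp pi (alpha 1) true) = a + b.
  by rewrite /subst_comp /= !subst_ext_cons !size_cat addn0.
have Eq : size S + size (pi false ++ P) = q + a.
  by rewrite size_cat /q; lia.
have r0 : rspecial L (F [:: false]).
  by apply: (@coded_rspecial _ _ HL _ _ _ HC [:: false]) => //; exact: coded_alt.
have [HD HZ HF HB] := And4 (st_D HS) (st_pend HS) (st_flag HS) (st_bound HS).
have [Hle Hlt Hc] := And3 (st_le HS) (st_lt HS) (st_cplx HS).
rewrite -/q -/a -/b in HD HZ HF HB Hle Hlt Hc.
have K : cplx L q + a + minn D a <= cplx L (q + a).
  have K2 : cplx L q + minn D a * 2 <= cplx L (q + minn D a).
    have [->|D0] := posnP D; first by rewrite min0n !addn0.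
    have [_ [Z [rZ sZ nZ]]] := HZ D0.
    apply: (cplx_branch HL (leqnn q) (frame_uniqZ [:: false] nZ)) => z.
    rewrite !inE => /orP[] /eqP ->; split => //; first by lia.
    by rewrite size_frame1 -/a; lia.
  have := cplx_addn HL (q + minn D a) (a - minn D a).
  have -> : q + minn D a + (a - minn D a) = q + a by lia.
  by lia.
split; rewrite ?Ea ?Eb ?Eq //; try lia.
- exact: coding_alpha.
- by move=> l ql; apply: HB; lia.
- move=> D0; have [|H [Z [rZ sZ nZ]]] := HZ; first lia.
  split; first lia.
  exists Z; split => //; first lia.
  apply: contra nZ; apply: suffix_trans.
  by have := frame_suffix HC [:: false]; rewrite /frame subst_ext1.
Qed.

(* Otherwise Z, W u and W v are three right-special branches. *)
Lemma strong_pending : Y [:: false; false] -> Y [:: true; true] -> D = 0.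
Proof.
move=> Y00 Y11; apply/eqP; rewrite -leqn0 leqNgt; apply/negP => D0.
have r0 : rspecial L (F [:: false]).
  by apply: (@coded_rspecial _ _ HL _ _ _ HC [:: false]) => //; exact: coded_alt.
have r1 : rspecial L (F [:: true]).
  by apply: (@coded_rspecial _ _ HL _ _ _ HC [:: true]) => //; exact: (coded_alt true).
have [HD HZ HB] := And3 (st_D HS) (st_pend HS D0) (st_bound HS).
have [Hle Hlt Hc] := And3 (st_le HS) (st_lt HS) (st_cplx HS).
rewrite -/q -/a -/b in HD HZ HB Hle Hlt Hc.
have [HI [Z [rZ sZ nZ]]] := HZ.
have [s0 s1] : size (F [:: false]) = q + a /\ size (F [:: true]) = q + b.
  by rewrite !size_frame1.
(* At length [q] the branches through u and v still share the suffix W, so only two branches are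
   counted. *)
have K1 : cplx L q + 1 * 2 <= cplx L (q + 1).
  apply: (cplx_branch HL (leqnn q) (frame_uniqZ [:: false] nZ)) => z.
  by rewrite !inE => /orP[] /eqP ->; split => //; lia.
pose m := minn a D.-1.
(* Three branches coexist until the first of [Z] and [F [:: false]] ends. *)
have K2 : cplx L q.+1 + m * 3 <= cplx L (q.+1 + m).
  apply: (cplx_branch HL (leqnn q.+1) (frame_uniq3 [::] [::] nZ)) => z.
  by rewrite !inE => /or3P[] /eqP ->; split => //; rewrite ?s0 ?s1 /m; lia.
pose k := maxn a D.-1 - m.
(* Two branches remain until the longer of [Z] and [F [:: false]] ends as well; [F [:: true]] is
   always one of them. *)
have K3 : cplx L (q.+1 + m) + k * 2 <= cplx L (q.+1 + m + k).
  have [aD|Da] := leqP a D.-1.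
    apply: (@cplx_branch _ _ HL q _ _ [:: Z; F [:: true]]).
    - by lia.
    - exact: frame_uniqZ.
    - by move=> z; rewrite !inE => /orP[] /eqP ->; split => //; rewrite ?s1 /k /m; lia.
  apply: (@cplx_branch _ _ HL q.+1 _ _ [:: F [:: false]; F [:: true]]).
  - by lia.
  - exact: (frame_uniq2 [::] [::]).
  - by move=> z; rewrite !inE => /orP[] /eqP ->; split => //; rewrite ?s0 ?s1 /k /m; lia.
(* The inequality of [st_pend] is what contradicts the bound 1.5 at this length. *)
have := HB (q.+1 + m + k); rewrite addn1 in K1.
by rewrite /k /m in K2 K3 *; lia.
Qed.

(* [B] is the maximal gap. *)
Lemma gap_le B g : ~ Y (nseq B.+1 false) ->
  Y (true :: nseq g false ++ [:: true]) -> g <= B.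
Proof.
move=> nB Yg; rewrite leqNgt; apply/negP => Bg; apply: nB.
apply: (coded_nseq_le HL HC Bg).
exact: (@coded_mid _ _ HL _ _ _ HC [:: true] _ [:: true]).
Qed.

(** A maximal run of zeros is preceded by 1, so [1 0^g] can be followed by 0 as part of [1 0^B]; the
    gap [g] itself lets 1 follow. *)
Lemma gap_rspecial B g : Y (nseq B false) -> ~ Y (nseq B.+1 false) -> g < B ->
  Y (true :: nseq g false ++ [:: true]) -> rspecial L (F (true :: nseq g false)).
Proof.
move=> YB nB gB Yg; apply: (coded_rspecial HL HC); last by rewrite -cats1.
have [[]] := cod_ext_l HC YB => // Y1B.
apply: (@coded_catl _ _ HL _ _ _ HC _ (nseq (B - g.+1) false)).
rewrite /= -nseqSr -nseqD; by have -> : g.+1 + (B - g.+1) = B by lia.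
Qed.

(** The bispecial word grows by [b] letters and [D <= b], so the pending branch is exhausted on the
    way and the new deficit is 0. *)
Lemma state_gamma2 : ~ Y [:: false; false] -> Y [:: true; true] ->
  state L false (S ++ pi true) P (subst_comp pi (gamma 2)) 0.
Proof.
move=> n00 Y11.
have Ea : size (subst_comp pi (gamma 2) false) = b.
  by rewrite /subst_comp subst_ext1.
have Eb : size (subst_comp pi (gamma 2) true) = a + b.
  by rewrite /subst_comp /= !subst_ext_cons !size_cat addn0.
have Eq : size (S ++ pi true) + size P = q + b.
  by rewrite size_cat /q; lia.
have r1 : rspecial L (F [:: true]).
  by apply: (@coded_rspecial _ _ HL _ _ _ HC [:: true]) => //; exact: (coded_alt true).
have [HD HZ HB] := And3 (st_D HS) (st_pend HS) (st_bound HS).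
have [Hle Hlt Hc] := And3 (st_le HS) (st_lt HS) (st_cplx HS).
rewrite -/q -/a -/b in HD HZ HB Hle Hlt Hc.
have K : cplx L q + b + D <= cplx L (q + b).
  have K2 : cplx L q + D * 2 <= cplx L (q + D).
    have [->|D0] := posnP D; first by rewrite !addn0.
    have [_ [Z [rZ sZ nZ]]] := HZ D0.
    apply: (cplx_branch HL (leqnn q) (frame_uniqZ [:: true] nZ)) => z.
    rewrite !inE => /orP[] /eqP ->; split => //; first by lia.
    by rewrite size_frame1 -/b; lia.
  have := cplx_addn HL (q + D) (b - D).
  have -> : q + D + (b - D) = q + b by lia.
  by lia.
split; rewrite ?Ea ?Eb ?Eq //; try lia.
- apply: coding_gamma => // g Yg; case: g Yg => [|[|g]] Yg; [by left|by right|].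
  case: n00; apply: (@coded_mid _ _ HL _ _ _ HC [:: true] _ (nseq g false ++ [:: true])).
  exact: Yg.
- by move=> l ql; apply: HB; lia.
Qed.

(** The gaps take only the values 0 and [B]. The branch of [0^(B-1)] may outlast the new bispecial
    word, and then becomes the pending branch. *)
Lemma state_gamma_strong : Y [:: false; false] -> Y [:: true; true] ->
  Y [:: false; true; false] \/ Y [:: true; true; true] ->
  exists n D', 1 < n /\
    state L false (S ++ pi true) P (subst_comp pi (gamma n)) D'.
Proof.
move=> Y00 Y11 Y3; have D0 := strong_pending Y00 Y11.
have [B [YB nB]] := coded_max_run HL HC.
have B2 : 1 < B.
  rewrite ltnNge; apply/negP => B1; apply: nB.
  exact: (coded_nseq_le HL HC (_ : B.+1 <= 2)).
have [HB Hle] := (st_bound HS, st_le HS).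
have [Hlt Hc] := (st_lt HS, st_cplx HS).
rewrite -/q -/a -/b D0 in HB Hle Hlt Hc.
have r1 : rspecial L (F [:: true]).
  by apply: (@coded_rspecial _ _ HL _ _ _ HC [:: true]) => //; exact: (coded_alt true).
have Kq : cplx L q < cplx L q.+1 by exact: cplx_lt.
(* If 010 occurs, 01 is right special, because some run of at least two 1s starts after a 0; if 111
   occurs, 11 is right special, because that run ends. *)
have [c rc] : exists c, rspecial L (F [:: c; true]).
  case: Y3 => Y3.
    exists false; apply: (@coded_rspecial _ _ HL _ _ _ HC [:: false; true]) => //.
    have [j Yj] := coded_ext_l HL HC false Y11.
    have E : nseq 2 true ++ nseq j true = nseq j true ++ nseq 2 true.
      by rewrite -!nseqD addnC.
    apply: (@coded_catl _ _ HL _ _ _ HC _ (nseq j true)).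
    by move: Yj; rewrite -[_ ++ _]/(nseq j true ++ nseq 2 true) -E.
  exists true; apply: (@coded_rspecial _ _ HL _ _ _ HC [:: true; true]) => //.
  have [j Yj] := coded_ext_r HL HC false Y11.
  have E : nseq 2 true ++ nseq j true ++ [:: false] =
      nseq j true ++ nseq 2 true ++ [:: false].
    by rewrite !catA -!nseqD addnC.
  apply: (@coded_catr _ _ HL _ _ _ HC (nseq j true)).
  by move: Yj; rewrite -[_ ++ _]/(nseq 2 true ++ nseq j true ++ [:: false]) E.
(* For a gap 0 < g < B, both F (1 0^g) and F (c 1) are right special, so that
   p(q + 1 + a + b) >= 3 (a + b), whereas q + 1 <= a + b. *)
have gaps g : Y (true :: nseq g false ++ [:: true]) -> g = 0 \/ g = B.
  move=> Yg; have gB := gap_le nB Yg; case: g Yg gB => [|g] Yg; first by left.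
  rewrite leq_eqVlt => /orP[/eqP ->|gB]; first by right.
  have rg := gap_rspecial YB nB gB Yg.
  rewrite nseqSr in rg.
  have K : cplx L q.+1 + (a + b) * 2 <= cplx L (q.+1 + (a + b)).
    apply: (cplx_branch HL (leqnn _) (frame_uniq2 (true :: nseq g false) [:: c])).
    move=> z; rewrite !inE => /orP[] /eqP ->; split => //; rewrite size_frame.
      by rewrite /= !subst_ext_cons subst_ext_rcons !size_cat -/a -/b; lia.
    rewrite /= !subst_ext_cons !size_cat -/b.
    by have ac : a <= size (pi c); [case: (c) | lia].
  by have := HB (q.+1 + (a + b)); lia.
pose n := B.+1.
(* The branch [F (nseq B.-1 false)] has length [q + B.-1 * a]; [D'] is what it offers beyond the new
   bispecial length [q + b]. *)
pose D' := (B.-1 * a).+1 - b.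
exists n, D'; split; first by rewrite /n; lia.
(* By maximality [0^B] is followed by 1, so [0^(B-1)] can be followed by both letters. *)
have r0 : rspecial L (F (nseq B.-1 false)).
  apply: (coded_rspecial HL HC).
    by rewrite -nseqSr prednK //; lia.
  have [j Yj] := coded_ext_r HL HC true YB.
  have Ej : j = 0.
    case: j Yj => // j Yj; case: nB.
    have E : nseq B.+1 false ++ nseq j false = nseq B false ++ nseq j.+1 false.
      by rewrite -!nseqD addnS.
    apply: (@coded_catl _ _ HL _ _ _ HC _ (nseq j false ++ [:: true])).
    by rewrite catA E -catA.
  move: Yj; rewrite Ej /= -(prednK (ltnW B2)) /= => Yj.
  by apply: (@coded_catr _ _ HL _ _ _ HC [:: false]); rewrite /= cats1 in Yj *.
have EB : B.-1 = B.-2.+1 by lia.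
have s0 : size (F (nseq B.-1 false)) = q + B.-1 * a.
  by rewrite size_frame -pow1 subst_ext_pow size_pow subst_ext1.
have Ea : size (subst_comp pi (gamma n) false) = b.
  by rewrite /subst_comp subst_ext1.
have Eb : size (subst_comp pi (gamma n) true) = B * a + b.
  by rewrite /subst_comp /= subst_ext_cat size_cat -pow1
    subst_ext_pow size_pow !subst_ext1.
have Eq : size (S ++ pi true) + size P = q + b.
  by rewrite size_cat /q; lia.
have EBa : B * a = B.-1 * a + a by rewrite -{1}(prednK (ltnW B2)) mulSn addnC.
have a0 : 0 < a by exact: coding_size_gt0 HC false.
have B1a : a <= B.-1 * a by rewrite leq_pmull //; lia.
have u2 : uniq (map (sfx q.+1) [:: F (nseq B.-1 false); F [:: true]]).
  by rewrite EB nseqSr; exact: (frame_uniq2 _ [::]).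
(* One step leads from [q] to [q.+1]; then two branches grow together until one ends or length
   [q + b] is reached, and the rest grows by at least one per length. *)
have K : cplx L q + b + minn (b.-1) (B.-1 * a) <= cplx L (q + b).
  have K2 : cplx L q.+1 + minn b.-1 (B.-1 * a) * 2
      <= cplx L (q.+1 + minn b.-1 (B.-1 * a)).
    apply: (cplx_branch HL (leqnn _) u2) => z.
    rewrite !inE => /orP[] /eqP ->; split => //; rewrite ?s0 ?size_frame1 -/b; lia.
  have := cplx_addn HL (q.+1 + minn b.-1 (B.-1 * a)) (b.-1 - minn b.-1 (B.-1 * a)).
  have -> : q.+1 + minn b.-1 (B.-1 * a) + (b.-1 - minn b.-1 (B.-1 * a)) = q + b by lia.
  by lia.
split; rewrite ?Ea ?Eb ?Eq //; rewrite ?EBa /D'; try lia.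
- by apply: coding_gamma => //; lia.
- by move=> l ql; apply: HB; lia.
- move=> D'0; split; first by lia.
  exists (F (nseq B.-1 false)); split => //; first by rewrite s0; lia.
  have E1 : (S ++ pi true) ++ P = F [:: true] by rewrite /F /frame subst_ext1 catA.
  rewrite E1; apply/negP => suf; move: u2; rewrite /= inE andbT => /eqP[].
  have b0 : 0 < b by exact: (coding_size_gt0 HC true).
  rewrite -(@sfx_sfx _ _ (size (F [:: true])) (F (nseq B.-1 false))).
    by rewrite (sfx_suffix suf).
  by rewrite (size_suffix suf) size_frame1 -/b; lia.
Qed.

(** The bispecial word grows by [a], the length of the shorter branch. The longer one, [F
    [:: true]], goes on to length [q + b] and becomes the pending branch, whence the deficit
    [b.+1 - a]. *)
Lemma state_delta : Y [:: false; false] -> Y [:: true; true] ->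
  ~ Y [:: false; true; false] -> ~ Y [:: true; true; true] ->
  state L true S (pi false ++ P) (subst_comp pi delta) (b.+1 - a).
Proof.
move=> Y00 Y11 n010 n111; have D0 := strong_pending Y00 Y11.
have [HB Hle] := (st_bound HS, st_le HS).
have [Hlt Hc] := (st_lt HS, st_cplx HS).
rewrite -/q -/a -/b D0 in HB Hle Hlt Hc.
have r0 : rspecial L (F [:: false]).
  by apply: (@coded_rspecial _ _ HL _ _ _ HC [:: false]) => //; exact: coded_alt.
have r1 : rspecial L (F [:: true]).
  by apply: (@coded_rspecial _ _ HL _ _ _ HC [:: true]) => //; exact: (coded_alt true).
have Kq : cplx L q < cplx L q.+1 by exact: cplx_lt.
have a0 : 0 < a by exact: coding_size_gt0 HC false.
have Ea : size (subst_comp pi delta false) = a.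
  by rewrite /subst_comp subst_ext1.
have Eb : size (subst_comp pi delta true) = a + b + b.
  by rewrite /subst_comp /= !subst_ext_cons !size_cat addn0 addnA.
have Eq : size S + size (pi false ++ P) = q + a.
  by rewrite size_cat /q; lia.
have u2 := frame_uniq2 [::] [::].
have K : cplx L q.+1 + a.-1 * 2 <= cplx L (q.+1 + a.-1).
  apply: (cplx_branch HL (leqnn _) u2) => z.
  by rewrite !inE => /orP[] /eqP ->; split => //; rewrite size_frame1 -/a -/b; lia.
have Eqa : q.+1 + a.-1 = q + a by lia.
rewrite Eqa in K.
split; rewrite ?Ea ?Eb ?Eq //; try lia.
- exact: coding_delta.
- by move=> l ql; apply: HB; lia.
- move=> D'0; split; first by lia.
  exists (F [:: true]); split => //; first by rewrite size_frame1 -/b; lia.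
  have E0 : S ++ pi false ++ P = F [:: false] by rewrite /F /frame subst_ext1.
  rewrite E0; apply/negP => suf; move: u2; rewrite /= inE andbT => /eqP[].
  rewrite -(@sfx_sfx _ _ (size (F [:: false])) (F [:: true])).
    by rewrite (sfx_suffix suf).
  by rewrite (size_suffix suf) size_frame1 -/a; lia.
Qed.

(** Otherwise all runs of 1s have length two. Aperiodicity then yields two distinct positive gaps,
    hence a second right-special branch besides [F [:: true]]; the growth over [b] lengths
    contradicts [st_flag]. *)
Lemma flag_010_or_111 : fl -> Y [:: false; false] -> Y [:: true; true] ->
  Y [:: false; true; false] \/ Y [:: true; true; true].
Proof.
move=> Hfl Y00 Y11; apply: contrapT => /not_orP[n010 n111].
have D0 := strong_pending Y00 Y11.
have HJ := st_flag HS Hfl.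
have [HB Hle] := (st_bound HS, st_le HS).
have [Hlt Hc] := (st_lt HS, st_cplx HS).
rewrite -/q -/a -/b D0 in HB Hle Hlt Hc HJ.
have r1 : rspecial L (F [:: true]).
  by apply: (@coded_rspecial _ _ HL _ _ _ HC [:: true]) => //; exact: (coded_alt true).
have Kq : cplx L q < cplx L q.+1 by exact: cplx_lt.
have [B [YB nB]] := coded_max_run HL HC.
have B2 : 1 < B.
  rewrite ltnNge; apply/negP => B1; apply: nB.
  exact: (coded_nseq_le HL HC (_ : B.+1 <= 2)).
(* If all positive gaps were equal to [B], the powers of [0^B 11] would all occur. *)
have [g [gB Yg]] : exists g, g.+1 < B /\ Y (true :: nseq g.+1 false ++ [:: true]).
  apply: contrapT => ng.
  apply: (@coded_no_growth _ _ HL _ _ _ HC [:: true; true]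
    (nseq B false ++ [:: true; true])) => [|//|j].
    by case: (B) B2.
  have [r Er] : exists r, [:: true; true] ++ pow (nseq B false ++ [:: true; true]) j
      = rcons (rcons r true) true.
    case: j => [|j]; first by exists [::].
    exists ([:: true; true] ++ pow (nseq B false ++ [:: true; true]) j ++ nseq B false).
    by rewrite powSr -!cats1 -!catA.
  rewrite powSr catA Er => /(cod_ext_r HC)[[]]; first by move=> /coded_rcons3.
  move=> /(coded_ext_r HL HC true)[j' Yj].
  have Ej : j'.+1 = B.
    have Yg : Y (true :: nseq j'.+1 false ++ [:: true]).
      apply: (@coded_catr _ _ HL _ _ _ HC (rcons r true)).
      by move: Yj; rewrite -!cats1 -!catA.
    have := gap_le nB Yg; rewrite leq_eqVlt => /orP[/eqP //|jB].
    by case: ng; exists j'.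
  have {Yj} : Y (rcons (rcons (rcons (rcons r true) true ++ nseq j' false) false) true).
    move: Yj; rewrite -!cats1 -!catA.
    by rewrite (catA (nseq j' false)) -(nseqD j' 1) addnC.
  move=> /(cod_ext_r HC)[[]]; last by move=> /coded_rcons3.
  rewrite -Ej nseqSr -!cats1 -!catA //.
have rg := gap_rspecial YB nB gB Yg; rewrite nseqSr in rg.
have K : cplx L q.+1 + b * 2 <= cplx L (q.+1 + b).
  apply: (cplx_branch HL (leqnn _) (frame_uniq2 (true :: nseq g false) [::])).
  move=> z; rewrite !inE => /orP[] /eqP ->; split => //; rewrite size_frame.
    by rewrite /= !subst_ext_cons subst_ext_rcons !size_cat -/a -/b; lia.
  by rewrite subst_ext1 -/b; lia.
by have := HB (q.+1 + b); lia.
Qed.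

End State.

(** * Identities between compositions of substitutions *)

Lemma subst_compA (A B C D : Type) (s : substitution C D)
    (t : substitution B C) (u : substitution A B) :
  subst_comp s (subst_comp t u) = subst_comp (subst_comp s t) u.
Proof. by apply/funext => a; rewrite /subst_comp -subst_ext_comp. Qed.

Lemma subst_alpha_nseq k n : subst_ext (alpha k) (nseq n false) = nseq n false.
Proof. by rewrite -pow1 subst_ext_pow subst_ext1. Qed.

Lemma subst_delta_nseq n : subst_ext delta (nseq n false) = nseq n false.
Proof. by rewrite -pow1 subst_ext_pow subst_ext1. Qed.

Lemma subst_alpha0 (A : Type) (pi : substitution bool A) :
  subst_comp pi (alpha 0) = pi.
Proof. by apply/funext => -[]; rewrite /subst_comp subst_ext1. Qed.

Lemma subst_alphaS k : subst_comp (alpha 1) (alpha k) = alpha k.+1.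
Proof.
apply/funext => -[] //; rewrite /subst_comp subst_ext_cat subst_alpha_nseq.
by rewrite subst_ext1 catA -(nseqD k 1) addn1.
Qed.

Lemma alpha_gamma k n : 0 < n ->
  subst_comp (alpha k) (gamma n) = tau k.+1 (k + n) 0.
Proof.
move=> n0; apply/funext => -[]; rewrite /subst_comp /= ?subst_ext_cat subst_ext1.
  by rewrite subst_alpha_nseq /= subn1 /=; congr (nseq _ _ ++ _); lia.
by rewrite /= subn1.
Qed.

Lemma alpha_delta_gamma k j n : 0 < n ->
  subst_comp (subst_comp (subst_comp (alpha k) delta) (alpha j)) (gamma n) =
  tau (k + j).+2 (k + j + n).+1 k.+1.
Proof.
move=> n0; rewrite -!subst_compA alpha_gamma // /subst_comp.
have E : subst_ext (alpha k) (subst_ext delta (tau j.+1 (j + n) 0 false)) =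
    tau (k + j).+2 (k + j + n).+1 k.+1 false.
  rewrite /= !subn1 /= subst_ext_cat subst_delta_nseq subst_ext1 subst_ext_cat.
  rewrite subst_alpha_nseq !subst_ext_cons cats0.
  rewrite -[RHS]/(nseq (k + j).+1 false ++ [:: true] ++ nseq k false ++ [:: true]).
  have -> : (k + j).+1 = j + (1 + k) by lia.
  by rewrite !nseqD -!catA.
apply/funext => -[] //.
(* The image of 1 is that of 0 preceded by a run of zeros, which [delta] and [alpha k] fix. *)
have -> : tau j.+1 (j + n) 0 true =
  nseq n.-1 false ++ tau j.+1 (j + n) 0 false.
  by rewrite /=; congr (nseq _ _ ++ _); lia.
rewrite 2!subst_ext_cat subst_delta_nseq subst_alpha_nseq E.
by rewrite /=; congr (nseq _ _ ++ _); lia.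
Qed.

(** * Desubstitution *)

Section Desubstitution.
Variables (A : finType) (L : seq A -> Prop) (HL : language L).

(** Recoding by [alpha 1] shortens every positive gap between 1s by one, so after finitely many
    steps 11 occurs. *)
Lemma alpha_iter_gap g fl S P pi D : state L fl S P pi D ->
  L (frame S P pi (true :: nseq g false ++ [:: true])) ->
  exists k P' D', state L fl S P' (subst_comp pi (alpha k)) D' /\
    L (frame S P' (subst_comp pi (alpha k)) [:: true; true]).
Proof.
elim: g P pi D => [|g IH] P pi D HS Yg.
  by exists 0, P, D; rewrite subst_alpha0.
have HC := st_cod HS.
have [Y11|n11] := pselect (L (frame S P pi [:: true; true])).
  by exists 0, P, D; rewrite subst_alpha0.
have HS' := state_alpha HL HS n11.
have [|k [P' [D' [HS'' Y11]]]] := IH _ _ _ HS'; last first.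
  by exists k.+1, P', D'; rewrite -subst_alphaS subst_compA.
(* The new frame of [1 0^g 1] is the old frame of [0 1 0^(g+1) 1 0]; the outer zeros are forced
   because 11 is excluded. *)
rewrite frame_alpha.
have [[/(coded_catl HL HC (w := [:: true; true])) //|Y0g]] := cod_ext_l HC Yg.
have {Y0g} : L (frame S P pi (rcons (false :: true :: nseq g.+1 false) true)).
  by rewrite -cats1.
move=> /(cod_ext_r HC)[[]]; first by move=> /(coded_rcons2 HL HS).
rewrite !subst_ext_cons subst_ext_cat subst_alpha_nseq subst_ext1.
by rewrite (nseqSr g) -!cats1 /= -!catA.
Qed.

Lemma alpha_iter fl S P pi D : state L fl S P pi D ->
  exists k P' D', state L fl S P' (subst_comp pi (alpha k)) D' /\
    L (frame S P' (subst_comp pi (alpha k)) [:: true; true]).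
Proof.
move=> HS; have HC := st_cod HS.
have [g Yg] := coded_ext_r HL HC true (coded_letter HL HS true).
exact: (alpha_iter_gap HS Yg).
Qed.

Lemma gamma_or_delta fl S P pi D : state L fl S P pi D ->
  L (frame S P pi [:: true; true]) ->
  (exists n S' P' D', 1 < n /\ state L false S' P' (subst_comp pi (gamma n)) D')
  \/ fl = false /\
     exists S' P' D', state L true S' P' (subst_comp pi delta) D'.
Proof.
move=> HS Y11.
have [Y00|n00] := pselect (L (frame S P pi [:: false; false])); last first.
  left; exists 2, (S ++ pi true), P, 0; split => //.
  exact: (state_gamma2 HL HS).
have [Y3|/not_orP[n010 n111]] := pselect (L (frame S P pi [:: false; true; false])
    \/ L (frame S P pi [:: true; true; true])).
  left; have [n [D' [n1 HS']]] := state_gamma_strong HL HS Y00 Y11 Y3.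
  by exists n, (S ++ pi true), P, D'.
right; split.
  by apply/negbTE/negP => /(flag_010_or_111 HL HS)/(_ Y00 Y11)[].
do 3 eexists; exact: (state_delta HL HS).
Qed.

(** One block: [alpha k] and then [gamma n], or [alpha k], [delta], [alpha j] and [gamma n]. After
    [delta] the flag is set, so the second round must end in a gamma. *)
Lemma tau_step fl S P pi D : state L fl S P pi D ->
  exists m n r, r < m < n /\
  exists S' P' D', state L false S' P' (subst_comp pi (tau m n r)) D'.
Proof.
move=> HS.
have [k [P1 [D1 [HS1 Y1]]]] := alpha_iter HS.
have [|[_ [S2 [P2 [D2 HS2]]]]] := gamma_or_delta HS1 Y1.
  move=> [n [S2 [P2 [D2 [n1 HS2]]]]].
  exists k.+1, (k + n), 0; split; first by lia.
  by exists S2, P2, D2; rewrite -alpha_gamma 1?ltnW // subst_compA.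
have [j [P3 [D3 [HS3 Y3]]]] := alpha_iter HS2.
have [|[]//] := gamma_or_delta HS3 Y3.
move=> [n [S4 [P4 [D4 [n1 HS4]]]]].
exists (k + j).+2, (k + j + n).+1, k.+1; split; first by lia.
by exists S4, P4, D4; rewrite -alpha_delta_gamma 1?ltnW // !subst_compA.
Qed.

Lemma tau_steps fl S P pi D : state L fl S P pi D ->
  exists m n r : nat -> nat, (forall k, r k < m k < n k) /\
  forall k, exists S' P' D',
    state L false S' P' (subst_comp pi (tau_prod m n r k)) D'.
Proof.
move=> HS.
pose good (p : substitution bool A) := exists fl S P D, state L fl S P p D.
have step (p : substitution bool A) : exists t : nat * nat * nat,
    good p -> t.2 < t.1.1 < t.1.2 /\
    exists S' P' D', state L false S' P' (subst_comp p (tau t.1.1 t.1.2 t.2)) D'.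
  (* The triple of zeros is a dummy value for substitutions that carry no state. *)
  have [[f [S1 [P1 [D1 HS1]]]]|ng] := pselect (good p); last by exists (0, 0, 0).
  by have [m [n [r H]]] := tau_step HS1; exists (m, n, r).
have /choice[f Hf] := step.
pose p := fix p k := if k is k'.+1 then
  subst_comp (p k') (tau (f (p k')).1.1 (f (p k')).1.2 (f (p k')).2) else pi.
have gp k : good (p k).
  elim: k => [|k IH]; first by exists fl, S, P, D.
  by have [_ [S' [P' [D' H]]]] := Hf _ IH; exists false, S', P', D'.
exists (fun k => (f (p k)).1.1), (fun k => (f (p k)).1.2), (fun k => (f (p k)).2).
split=> [k|k]; first by have [] := Hf _ (gp k).
have -> : subst_comp pi (tau_prod (fun k => (f (p k)).1.1)
   (fun k => (f (p k)).1.2) (fun k => (f (p k)).2) k) = p k.+1.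
  elim: k => [//|k IH]; rewrite [tau_prod _ _ _ _]/=.
  by rewrite subst_compA IH.
by have [] := Hf _ (gp k).
Qed.

End Desubstitution.

(** * First returns to a bispecial word *)

Section FirstReturns.
Variables (A : finType) (L : seq A -> Prop) (HL : language L).
Variables (W : seq A) (c d : A).
Hypothesis cd : c != d.
Hypothesis LWc : L (rcons W c).
Hypothesis Wletter : forall e, L (rcons W e) -> e = c \/ e = d.
Hypothesis Wright : forall z, size z = size W -> rspecial L z -> z = W.
Hypothesis Wleft : forall z, size z = size W -> lspecial L z -> z = W.

Let q := size W.
Definition win i (x : seq A) := take (size W) (drop i x).

(** These are the labels of the loops at W in the Rauzy graph: [W ++ u] ends at the next occurrence
    of W. *)
Definition first_return (u : seq A) := [/\ u != [::], L (W ++ u),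
  win (size u) (W ++ u) = W &
  forall i, 0 < i < size u -> win i (W ++ u) <> W].

Lemma win0 (x : seq A) : win 0 (W ++ x) = W.
Proof. by rewrite /win drop0 take_size_cat. Qed.

Lemma win_take i j (x : seq A) : i <= j -> win i (take (q + j) x) = win i x.
Proof.
move=> ij; have E : q + j = (q + j - i) + i by lia.
by rewrite /win E -take_drop take_takel // -/q; lia.
Qed.

Lemma take_catW j (x : seq A) : take (q + j) (W ++ x) = W ++ take j x.
Proof. by rewrite take_cat ltnNge leq_addr /= addKn. Qed.

Lemma win_split i (x : seq A) : x = take i x ++ win i x ++ drop (i + q) x.
Proof. by rewrite /win addnC -drop_drop cat_take_drop cat_take_drop. Qed.

Lemma size_win i (x : seq A) : i + q <= size x -> size (win i x) = q.
Proof. by move=> s; rewrite size_takel // size_drop -/q; lia. Qed.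

Lemma infix_win (z : seq A) : infix W z -> exists2 i, i + q <= size z & win i z = W.
Proof.
case/infixP => [s1 [s2 ->]]; exists (size s1).
  by rewrite !size_cat leq_add2l leq_addr.
by rewrite /win drop_size_cat // take_size_cat.
Qed.

Lemma first_return_ex e : L (rcons W e) -> exists u, first_return (e :: u).
Proof.
move=> Le; have LW : L W by move: Le; rewrite -cats1; exact: lang_catl.
have [N HN] := lang_recur HL LW.
have [y sy Ly] := lang_catr_ext HL N Le; rewrite cat_rcons in Ly.
pose X := W ++ e :: y.
have sX : size X = q + (size y).+1 by rewrite size_cat.
have [i0 [i0_gt0 i0_le Wi0]] : exists i, [/\ 0 < i, i + q <= size X & win i X = W].
  have Ld : L (drop 1 X) by apply: (lang_infix HL) Ly; exact: infix_drop.
  have [|i] := infix_win (HN _ Ld _); first by rewrite size_drop sX; lia.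
  rewrite size_drop => si Wi; exists i.+1; split => //; first by lia.
  by rewrite -[RHS]Wi /win drop_drop addn1.
have ex : exists i, [&& 0 < i, i + q <= size X & win i X == W].
  by exists i0; apply/and3P; split => //; apply/eqP.
case: (ex_minnP ex) => [[//|i]] /and3P[_ si /eqP Wi] Hmin.
have tX : W ++ take i.+1 (e :: y) = take (q + i.+1) X by rewrite take_catW.
have sx : size (take i.+1 (e :: y)) = i.+1.
  by rewrite size_takel //=; move: si; rewrite sX; lia.
exists (take i y); split => //.
- rewrite -[e :: _]/(take i.+1 (e :: y)) tX.
  by apply: (lang_infix HL) Ly; exact: infix_take.
- by rewrite -[e :: _]/(take i.+1 (e :: y)) sx tX win_take.
- move=> j; rewrite -[e :: _]/(take i.+1 (e :: y)) sx tX => ji.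
  rewrite win_take; last by lia.
  move=> Wj; have : i.+1 <= j; last by lia.
  by apply: Hmin; apply/and3P; split; [lia | lia | apply/eqP].
Qed.

(** After the first letter nothing is free: two different continuations would make the current
    window right special, hence equal to W, before the return is complete. *)
Lemma return_det u x t : first_return u -> L (W ++ x) ->
  ohead x = ohead u -> t <= size x -> t <= size u -> take t x = take t u.
Proof.
move=> [u0 Lu _ Hu] Lx hd; elim: t => [|[|t] IH] tx tu; first by rewrite !take0.
  by case: x u hd tx {u0 Lu Hu Lx IH tu} => [|e x] [|e' u] //= [->]; rewrite !take0.
have {}IH := IH (ltnW tx) (ltnW tu).
rewrite (take_nth c) // [RHS](take_nth c) // IH; congr rcons.
apply/eqP; apply: contrapT => /negP ne.
have L1 : L (rcons (W ++ take t.+1 u) (nth c x t.+1)).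
  rewrite rcons_cat -IH -take_nth //; apply: (lang_infix HL) Lx.
  by apply/infixP; exists [::], (drop t.+2 x); rewrite -catA cat_take_drop.
have L2 : L (rcons (W ++ take t.+1 u) (nth c u t.+1)).
  rewrite rcons_cat -take_nth //; apply: (lang_infix HL) Lu.
  by apply/infixP; exists [::], (drop t.+2 u); rewrite -catA cat_take_drop.
apply: (Hu t.+1); first by lia.
rewrite -(@win_take _ t.+1) // take_catW.
have sT : size (W ++ take t.+1 u) = t.+1 + q.
  by rewrite size_cat size_takel ?(ltnW tu) // addnC.
apply: Wright; first by rewrite size_win ?sT.
apply: (rspecial_suffix HL (s := W ++ take t.+1 u)).
  rewrite /win take_oversize ?size_drop ?sT ?addKn //; exact: suffix_drop.
by exists (nth c x t.+1), (nth c u t.+1).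
Qed.

Lemma first_return_uniq u v : first_return u -> first_return v ->
  ohead u = ohead v -> u = v.
Proof.
wlog uv : u v / size u <= size v.
  by move=> H fu fv E; case/orP: (leq_total (size u) (size v)) => ?;
    [apply: H | apply/esym; apply: H].
move=> fu fv E; have [u0 Lu Wu _] := fu; have [v0 Lv _ Hv] := fv.
have tE := return_det fv Lu E (leqnn _) uv; rewrite take_size in tE.
move: uv; rewrite leq_eqVlt => /orP[/eqP uv|uv].
  by rewrite tE uv take_size.
case: (Hv (size u)); first by rewrite uv lt0n size_eq0 u0.
by rewrite -(@win_take _ (size u)) // take_catW -tE.
Qed.

(* Reading backwards, the letters are forced as long as W is not met, since W is
   the only left-special word of its length. *)
Lemma return_back u v i j : first_return u -> first_return v ->
  i < size u -> j < size v -> win i (W ++ u) = win j (W ++ v) ->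
  i = j /\ take (i + q) (W ++ u) = take (j + q) (W ++ v).
Proof.
move=> [u0 Lu Wu Hu] [v0 Lv Wv Hv].
elim: i j => [|i IH] [|j] iu jv E.
- by rewrite !add0n !take_size_cat.
- by case: (Hv j.+1) => //; rewrite -E win0.
- by case: (Hu i.+1) => //; rewrite E win0.
have su : i < size (W ++ u) by rewrite size_cat; lia.
have sv : j < size (W ++ v) by rewrite size_cat; lia.
pose x := nth c (W ++ u) i; pose y := nth c (W ++ v) j.
have winS w k : k < size (W ++ w) ->
    win k (W ++ w) = take q (nth c (W ++ w) k :: win k.+1 (W ++ w)).
  move=> kw; rewrite /win (drop_nth c kw) -/q.
  by case: (q) => //= q'; rewrite take_takel.
have Lext w k : L (W ++ w) -> k < size (W ++ w) ->
    L (nth c (W ++ w) k :: win k.+1 (W ++ w)).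
  move=> Lw kw; apply: (lang_infix HL) Lw; apply/infixP.
  exists (take k (W ++ w)), (drop (k.+1 + q) (W ++ w)).
  rewrite -[LHS](cat_take_drop k); congr (_ ++ _).
  by rewrite (drop_nth c kw) /= /win addnC -drop_drop cat_take_drop.
have xy : x = y.
  apply/eqP; apply: contrapT => /negP ne; apply: (Hu i.+1) => //.
  apply: Wleft; first by rewrite size_win // size_cat -/q; lia.
  exists x, y; split => //; first exact: Lext.
  by rewrite E; exact: Lext.
have [|||ij tE] := IH j; [lia|lia|by rewrite (winS u i) // (winS v j) // -/x -/y xy E|].
split; first by rewrite ij.
have takeS w k : k < size (W ++ w) -> take (k.+1 + q) (W ++ w) =
    rcons (take k (take (k + q) (W ++ w))) (nth c (W ++ w) k) ++ win k.+1 (W ++ w).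
  move=> kw; rewrite take_takel ?leq_addr // -take_nth // /win -/q.
  by rewrite takeD.
by rewrite (takeS u i) // (takeS v j) // tE -/x -/y xy E ij.
Qed.

Section Loops.
Variables u v : seq A.
Hypotheses (fu : first_return u) (fv : first_return v).
Hypotheses (hu : ohead u = Some c) (hv : ohead v = Some d).
Hypothesis uv : size u <= size v.

Let pi : substitution bool A := fun b => if b then v else u.

Lemma first_return_pi b : first_return (pi b). Proof. by case: b. Qed.

Lemma ohead_pi b : ohead (pi b) = Some (if b then d else c).
Proof. by case: b. Qed.

Lemma head_letter x : x != [::] -> L (W ++ x) ->
  exists b, ohead x = ohead (pi b).
Proof.
case: x => // e x _; rewrite -cat_rcons => /(lang_catl HL)/Wletter[]->.
  by exists false; rewrite ohead_pi.
by exists true; rewrite ohead_pi.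
Qed.

Lemma pi_suffix w : exists r, W ++ subst_ext pi w = r ++ W.
Proof.
elim/last_ind: w => [|w b [r IH]]; first by exists [::]; rewrite cats0.
have [_ _ Wb _] := first_return_pi b.
exists (r ++ take (size (pi b)) (W ++ pi b)).
rewrite subst_ext_rcons catA IH -!catA; congr (_ ++ _).
rewrite -[LHS](cat_take_drop (size (pi b))); congr (_ ++ _).
rewrite -[RHS]Wb /win take_oversize // size_drop size_cat; lia.
Qed.

Lemma pi_suffix_letter b : exists r s, W ++ pi b = r ++ s :: W /\
  size r = (size (pi b)).-1.
Proof.
have [r] := pi_suffix [:: b]; rewrite subst_ext1 => E.
have sr : size r = size (pi b) by have := congr1 size E; rewrite !size_cat; lia.
have [p0 _ _ _] := first_return_pi b.
case/lastP: r E sr => [|r s] E sr; first by case: (pi b) p0 sr.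
by exists r, s; rewrite E cat_rcons; split => //; rewrite -sr size_rcons.
Qed.

Lemma pi_loops_coding : coding L W [::] pi.
Proof.
split.
- exists (fun b => if b then d else c) => //= b; have := ohead_pi b.
  by case: (pi b) => //= e x [->]; rewrite eqxx prefix0s.
- have [r0 [s0 [E0 z0]]] := pi_suffix_letter false.
  have [r1 [s1 [E1 z1]]] := pi_suffix_letter true.
  exists (fun b => if b then s1 else s0) => /= [|[]]; last first.
  + by rewrite E0 suffix_suffix.
  + by rewrite E1 suffix_suffix.
  (* With equal letters, the windows one place before the final W agree, and reading backwards gives
     u = v although their first letters differ. *)
  apply/eqP => s01; subst s1.
  have p0 b : 0 < size (pi b).
    by have [] := first_return_pi b; case: (pi b).
  have [|||ij tE] := @return_back (pi false) (pi true) (size r0) (size r1)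
      fu fv; rewrite ?z0 ?z1 ?prednK //.
    by rewrite -{1}z0 -z1 /win E0 E1 !drop_size_cat.
  have r01 : r0 = r1.
    rewrite -[r0](@take_size_cat _ (size r0) _ (s0 :: W)) // -E0.
    rewrite -[RHS](@take_size_cat _ (size r1) _ (s0 :: W)) // -E1.
    rewrite -(@take_takel _ (size r0) (size r0 + q)) ?leq_addr //.
    rewrite -(@take_takel _ (size r1) (size r1 + q)) ?leq_addr //.
    by rewrite tE ij.
  have E : W ++ u = W ++ v.
    by rewrite -[u]/(pi false) -[v]/(pi true) E0 E1 r01.
  have : u = v by have := congr1 (drop q) E; rewrite !drop_size_cat.
  move=> uv'; move: cd; have := hv; rewrite -uv' hu => -[->].
  by rewrite eqxx.
- by rewrite cats0; move: LWc; rewrite -cats1; exact: lang_catl.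
- move=> w; rewrite /frame cats0 => Lw.
  have [r Er] := pi_suffix w.
  (* As v is the longer return word, [size v] letters contain a complete return. *)
  have [y sy] := lang_catr_ext HL (size v) Lw.
  rewrite Er -catA => Ly; have LWy := lang_catr HL Ly.
  have y0 : y != [::] by case: fv => v0 _ _ _; rewrite -size_eq0 sy size_eq0.
  have [b Eb] := head_letter y0 LWy; exists b.
  have sb : size (pi b) <= size y by rewrite sy; case: (b).
  have tE := return_det (first_return_pi b) LWy Eb sb (leqnn _).
  rewrite subst_ext_rcons cats0 catA Er -catA.
  apply: (lang_catl HL (t := drop (size (pi b)) y)).
  by rewrite -!catA -[X in X ++ drop _ _]take_size -tE cat_take_drop.
- move=> w; rewrite /frame cats0 => Lw.
  have LW : L W by move: LWc; rewrite -cats1; exact: lang_catl.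
  have [N HN] := lang_recur HL LW.
  have [y sy] := lang_catl_ext HL N.+1 Lw.
  rewrite catA; set X := y ++ W => LX.
  have sX : size X = N.+1 + q by rewrite size_cat sy.
  have LX0 : L X by exact: lang_catl LX.
  have [i0 i0N Wi0] : exists2 i, i <= N & win i X = W.
    have LtX : L (take (q + N) X) by apply: (lang_infix HL) LX0; exact: infix_take.
    have [|i] := infix_win (HN _ LtX _); first by rewrite size_takel ?sX; lia.
    rewrite size_takel; last by rewrite sX; lia.
    move=> iN; rewrite win_take => [Wi|]; first by exists i => //; lia.
    by lia.
  have ex : exists i, (i <= N) && (win i X == W).
    by exists i0; rewrite i0N Wi0 eqxx.
  have ub i : (i <= N) && (win i X == W) -> i <= N by case/andP.
  (* The last occurrence of W before the final one; what lies between their ends is a first return,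
     hence u or v. *)
  case: (ex_maxnP ex ub) => i /andP[iN /eqP Wi] Hmax.
  pose x := drop (i + q) X.
  have EX : X = take i X ++ W ++ x by rewrite {1}[X](win_split i) Wi.
  have sx : size x = N.+1 - i by rewrite size_drop sX; lia.
  have dX : drop i X = W ++ x.
    by rewrite {1}EX drop_size_cat // size_takel // sX; lia.
  have winx j : win j (W ++ x) = win (j + i) X by rewrite -dX /win drop_drop.
  have fx : first_return x.
    split; first by rewrite -size_eq0 sx; lia.
    - by move: LX0; rewrite EX; exact: lang_catr.
    - rewrite winx sx subnK; last by lia.
      by rewrite /win /X drop_size_cat // take_size.
    - move=> j ji; rewrite winx => Wj.
      have : j + i <= i; last by lia.
      by apply: Hmax; rewrite Wj eqxx andbT; lia.
  have [x0 Lx _ _] := fx.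
  have [b Eb] := head_letter x0 Lx; exists b.
  rewrite cats0 subst_ext_cons -(first_return_uniq fx (first_return_pi b) Eb).
  by move: LX; rewrite EX -!catA; exact: lang_catr.
Qed.

(** The words of length [q] are the vertices of the two loops. The second list starts at index 1
    because W, common to both loops, is counted once. *)
Lemma cplx_loops : (cplx L q).+1 = size u + size v.
Proof.
pose T := [seq win i (W ++ u) | i <- iota 0 (size u)] ++
          [seq win j (W ++ v) | j <- iota 1 (size v).-1].
have [[u0 Lu _ _] [v0 Lv _ _]] := (fu, fv).
have sT : (size T).+1 = size u + size v.
  have v_gt0 : 0 < size v by rewrite lt0n size_eq0.
  by rewrite size_cat !size_map !size_iota; lia.
rewrite -sT; congr S; apply/eqP; rewrite eqn_leq; apply/andP; split.
  apply: cplx_le => t Lt st.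
  have LW : L W by move: LWc; rewrite -cats1; exact: lang_catl.
  have [N HN] := lang_recur HL LW.
  have [y sy LX] := lang_catl_ext HL N Lt.
  set X := y ++ t in LX; have sX : size X = N + q by rewrite size_cat sy st.
  have [|i0 i0N Wi0] := infix_win (HN _ LX _); first by rewrite sX leq_addr.
  have ex : exists i, (i <= N) && (win i X == W).
    by exists i0; rewrite Wi0 eqxx; lia.
  have ub i : (i <= N) && (win i X == W) -> i <= N by case/andP.
  case: (ex_maxnP ex ub) => i /andP[iN /eqP Wi] Hmax.
  pose x := drop (i + q) X.
  have EX : X = take i X ++ W ++ x by rewrite {1}[X](win_split i) Wi.
  have sx : size x = N - i by rewrite size_drop sX; lia.
  have dX : drop i X = W ++ x.
    by rewrite {1}EX drop_size_cat // size_takel // sX; lia.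
  have winx j : win j (W ++ x) = win (j + i) X by rewrite -dX /win drop_drop.
  have Et : t = win (size x) (W ++ x).
    rewrite winx sx subnK // /win /X drop_size_cat // take_oversize //.
    by rewrite st.
  have [x0|x0] := eqVneq x [::].
    rewrite mem_cat; apply/orP; left; apply/mapP; exists 0.
      by rewrite mem_iota lt0n size_eq0.
    by rewrite Et x0 !win0.
  have Lx : L (W ++ x) by move: LX; rewrite EX; exact: lang_catr.
  have [b Eb] := head_letter x0 Lx.
  have xb : size x < size (pi b).
    rewrite ltnNge; apply/negP => bx.
    have tE := return_det (first_return_pi b) Lx Eb bx (leqnn _).
    have [p0 _ Wb _] := first_return_pi b.
    have : size (pi b) + i <= i.
      apply: Hmax; rewrite -winx -(@win_take _ (size (pi b))) // take_catW tE.
      by rewrite take_size Wb eqxx andbT; lia.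
    have p_gt0 : 0 < size (pi b) by rewrite lt0n size_eq0.
    by lia.
  have tE := return_det (first_return_pi b) Lx Eb (leqnn _) (ltnW xb).
  rewrite take_size in tE.
  have {}Et : t = win (size x) (W ++ pi b).
    by rewrite Et -[RHS](@win_take _ (size x)) // take_catW -tE.
  have x_gt0 : 0 < size x by rewrite lt0n size_eq0.
  rewrite mem_cat; apply/orP.
  case: (b) xb Et => /= xb Et; [right|left]; apply/mapP; exists (size x) => //;
    rewrite mem_iota; lia.
have Lwin w i : L (W ++ w) -> L (win i (W ++ w)).
  move=> Lw; apply: (lang_infix HL) Lw; apply: (@infix_trans _ (drop i (W ++ w))).
    exact: infix_take.
  exact: infix_drop.
apply: cplx_ge; last first.
  move=> t; rewrite mem_cat => /orP[] /mapP[i]; rewrite mem_iota => ii ->;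
    split; rewrite ?size_win ?size_cat -/q //; try exact: Lwin; lia.
rewrite cat_uniq; apply/and3P; split.
- rewrite map_inj_in_uniq ?iota_uniq // => i j; rewrite !mem_iota => ii jj E.
  by have [] := return_back fu fu _ _ E; lia.
- apply/hasPn => t /mapP[j]; rewrite mem_iota => jj ->.
  apply/negP => /mapP[i]; rewrite mem_iota => ii E.
  have [||ji] := return_back fv fu _ _ E; [lia|lia|].
  rewrite ji addnC !take_catW => /(congr1 (drop q)); rewrite !drop_size_cat //.
  have i0 : 0 < i by lia.
  case: i i0 ii {E ji} => // i _ _; case: (v) hv => //= e x [->].
  case: (u) hu => //= e' x' [->] [E].
  by move: cd; rewrite E eqxx.
- rewrite map_inj_in_uniq ?iota_uniq // => i j; rewrite !mem_iota => ii jj E.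
  by have [] := return_back fv fv _ _ E; lia.
Qed.

Lemma state_loops : (forall l, q <= l -> 2 * cplx L l < 3 * l) ->
  state L false W [::] pi 0.
Proof.
move=> HB; have := cplx_loops; have := cplx_gt HL q => ? ?.
split; rewrite /= ?addn0 //; try lia.
  exact: pi_loops_coding.
by rewrite -/q; lia.
Qed.

End Loops.

End FirstReturns.

(** * Finding a bispecial word *)

Section Bispecial.
Variables (A : finType) (L : seq A -> Prop) (HL : language L).

(** A second right-special word, or a third letter after [R], would add at least two words of length
    [q.+1]. *)
Lemma rspecial_unique q : cplx L q.+1 <= (cplx L q).+1 ->
  exists R c d, [/\ size R = q, c != d, L (rcons R c), L (rcons R d) &
    (forall z, size z = q -> rspecial L z -> z = R) /\
    (forall e, L (rcons R e) -> e = c \/ e = d)].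
Proof.
move=> Hq; have [R sR [c [d [cd Lc Ld]]]] := rspecial_ex HL q.
exists R, c, d; split => //; split.
  move=> z sz rz; apply/eqP; apply: contrapT => /negP zR.
  have : cplx L q + size [:: z; R] <= cplx L q.+1.
    apply: (cplx_rspecial HL) => [|t]; first by rewrite /= inE zR.
    by rewrite !inE => /orP[] /eqP ->; split => //; exists c, d.
  by rewrite /=; lia.
move=> e Le; have [->|ec] := eqVneq e c; first by left.
have [->|ed] := eqVneq e d; first by right.
have [f Hf] := ext_fun HL.
have : exists x y, [/\ x != y, L (rcons R x), L (rcons R y), x != f R & y != f R].
  have [E|cf] := eqVneq c (f R).
    by exists d, e; rewrite -E eq_sym ed eq_sym cd.
  have [E|df] := eqVneq d (f R); last by exists c, d.
  by exists c, e; rewrite -E eq_sym ec cd.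
case=> x [y [xy Lx Ly xf yf]].
have : cplx L q + size [:: (R, x); (R, y)] <= cplx L q.+1.
  apply: (cplx_pairs Hf) => [|t]; first by rewrite /= inE xpair_eqE eqxx /= xy.
  by rewrite !inE => /orP[] /eqP ->.
by rewrite /=; lia.
Qed.

(* The only left-special word L0 cannot be met strictly inside a shortest word
   W leading from L0 to R0, hence the letters to the left of R0 are forced. *)
Lemma shortest_suffix L0 R0 W : size L0 = size R0 ->
  (forall z, size z = size R0 -> lspecial L z -> z = L0) ->
  L W -> suffix R0 W ->
  (forall w, L w -> prefix L0 w -> suffix R0 w -> size W <= size w) ->
  forall z, L z -> suffix R0 z -> size z <= size W -> suffix z W.
Proof.
move=> s0 Lspe LW RW Wmin; elim=> [|x z IH] Lz Rz zW; first exact: suffix0s.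
have [zR|Rz'] := leqP (size (x :: z)) (size R0).
  have /suffixP[r Er] := Rz.
  case: r Er => [-> //|e r E].
  by have := congr1 size E; move: zR; rewrite /= size_cat; lia.
have Rz0 : suffix R0 z.
  have /suffixP[r Er] := Rz.
  case: r Er Rz' => [->|e r [_ ->] _]; first by rewrite ltnn.
  exact: suffix_suffix.
have Lz0 : L z by apply: (lang_infix HL) Lz; exact: infix_cons.
have /suffixP[r Er] := IH Lz0 Rz0 (ltnW zW).
case/lastP: r Er => [Er|r y Er]; first by move: zW; rewrite Er ltnn.
have [->|xy] := eqVneq x y; first by rewrite Er cat_rcons suffix_suffix.
have Lyz : L (y :: z).
  by apply: (lang_infix HL) LW; rewrite Er cat_rcons suffix_infix.
suff : size W <= size z by move: zW => /=; lia.
apply: Wmin => //.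
have E : take (size R0) z = L0.
  apply: Lspe; first by rewrite size_takel // -ltnS.
  exists x, y; split => //.
    apply: (lang_infix HL) Lz; rewrite -[_ :: take _ _]/(take (size R0).+1 (x :: z)).
    exact: infix_take.
  apply: (lang_infix HL) Lyz; rewrite -[_ :: take _ _]/(take (size R0).+1 (y :: z)).
  exact: infix_take.
by rewrite -E prefix_take.
Qed.

End Bispecial.

Lemma suffix_size_eq (T : eqType) (s t : seq T) :
  suffix s t -> size s = size t -> s = t.
Proof.
by case/suffixP => -[|x r] -> //; rewrite size_cat /=; lia.
Qed.

(** At a length where p grows by at most one, let [L0] and [R0] be the unique left- and
    right-special words. A shortest word [W] leading from [L0] to [R0] is bispecial, and is the only
    left- or right-special word of its length. *)
Lemma initial_state (A : finType) (L : seq A -> Prop) (N : nat) :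
  language L -> (forall l, N <= l -> 2 * cplx L l < 3 * l) ->
  exists S P pi D, state L false S P pi D.
Proof.
move=> HL HB.
have HLr := rev_language HL.
have [q0 Nq0 Hq0] : exists2 q, N <= q & cplx L q.+1 <= (cplx L q).+1.
  apply: contrapT => nq.
  have H t : 2 * t <= cplx L (N + t).
    elim: t => // t IH; rewrite leqNgt; apply/negP => H; apply: nq.
    by exists (N + t); [exact: leq_addr | rewrite -addnS; lia].
  (* With t = 3N + 1, growth by two at every step would give 4t <= 2p(N + t) < 3(N + t), that is 12N
     + 4 < 12N + 3. *)
  by have := H (3 * N).+1; have := HB (N + (3 * N).+1); lia.
have [R0 [c [d [sR cd LRc LRd [Runiq Rletter]]]]] := rspecial_unique HL Hq0.
have [L0r [c' [d' [sL cd' LLc LLd [Luniq _]]]]] :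
    exists R c d, [/\ size R = q0, c != d, (L \o rev) (rcons R c),
    (L \o rev) (rcons R d) &
    (forall z, size z = q0 -> rspecial (L \o rev) z -> z = R) /\
    (forall e, (L \o rev) (rcons R e) -> e = c \/ e = d)].
  by apply: (rspecial_unique HLr); rewrite !cplx_rev.
pose L0 := rev L0r.
have LL0 : L L0.
  have := LLc; rewrite /= rev_rcons; apply: (lang_infix HL); exact: infix_cons.
have sL0 : size L0 = q0 by rewrite size_rev.
have LR0 : L R0 by move: LRc; rewrite -cats1; exact: lang_catl.
have Lspe z : size z = q0 -> lspecial L z -> z = L0.
  by move=> sz /(proj2 (rspecial_rev L z)) rz;
    rewrite -[z]revK (Luniq (rev z)) // size_rev.
clearbody L0.
pose good n := `[< exists w, [/\ size w = n, L w, prefix L0 w & suffix R0 w] >].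
have exg : exists n, good n.
  have [N0 HN0] := lang_recur HL LR0.
  have [y sy Ly] := lang_catr_ext HL N0 LL0.
  have [s1 [s2 E]] : exists s1 s2 : seq A, L0 ++ y = s1 ++ R0 ++ s2.
    by apply/infixP; apply: HN0 => //; rewrite size_cat sy leq_addl.
  have Ls : L (s1 ++ R0).
    by apply: (lang_infix HL) Ly; rewrite E catA prefix_infix.
  exists (size (s1 ++ R0)); apply/asboolP; exists (s1 ++ R0); split => //.
    rewrite prefixE; have := @take_size_cat _ (size L0) L0 y erefl.
    rewrite E catA take_cat; case: ltnP => [_ -> //|H].
    have -> : size L0 - size (s1 ++ R0) = 0 by rewrite size_cat sL0 sR; lia.
    by rewrite take0 cats0 => ->; rewrite take_size.
  exact: suffix_suffix.
case: (ex_minnP exg) => n /asboolP[W [sW LW pW uW]] nmin.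
have Wmin w : L w -> prefix L0 w -> suffix R0 w -> size W <= size w.
  by move=> Lw pw uw; rewrite sW; apply: nmin; apply/asboolP; exists w.
have Wsuf z : L z -> suffix R0 z -> size z <= size W -> suffix z W.
  by apply: (shortest_suffix HL (L0 := L0)); rewrite ?sL0 ?sR.
(* The mirror image of [Wsuf], with the roles of [L0] and [R0] exchanged. *)
have Wpre z : L z -> prefix L0 z -> size z <= size W -> prefix z W.
  rewrite -suffix_rev => Lz; rewrite -suffix_rev -(size_rev z) -(size_rev W).
  apply: (shortest_suffix HLr (L0 := rev R0)); rewrite /= ?size_rev ?revK //.
  - by rewrite sR sL0.
  - move=> t st; rewrite -{1}[t]revK => /lspecial_rev rt.
    by rewrite -[t]revK (Runiq (rev t)) // size_rev st.
  - by rewrite suffix_rev.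
  - move=> w Lw; rewrite -[w]revK prefix_rev suffix_rev size_rev => uw pw.
    exact: Wmin.
have q0W : q0 <= size W by rewrite -sR size_suffix.
(* The letters to the left of [R0] are forced up to the length of [W], so each right extension of
   [R0] extends [W]. *)
have LW_R e : L (rcons R0 e) -> L (rcons W e).
  move=> Le; have [y sy] := lang_catl_ext HL (size W - q0) Le.
  rewrite -rcons_cat => Ly.
  suff -> : W = y ++ R0 by [].
  have sy' : size (y ++ R0) = size W by rewrite size_cat sy sR subnK.
  apply/esym/suffix_size_eq => //; apply: Wsuf; rewrite ?sy' ?suffix_suffix //.
  by move: Ly; rewrite -cats1; exact: lang_catl.
have Wletter e : L (rcons W e) -> e = c \/ e = d.
  move=> Le; apply: Rletter; apply: (lang_infix HL) Le.
  by have /suffixP[r ->] := uW; rewrite rcons_cat suffix_infix.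
have Wright z : size z = size W -> rspecial L z -> z = W.
  move=> sz rz; apply: suffix_size_eq => //; apply: Wsuf; rewrite ?sz //.
    exact: (rspecial_L HL).
  rewrite -(Runiq (sfx q0 z)) ?suffix_sfx ?size_sfx ?sz //.
  exact: (rspecial_suffix HL) (suffix_sfx _ _) rz.
have Wleft z : size z = size W -> lspecial L z -> z = W.
  move=> sz lz; have Lz : L z.
    by have [a [b [_ La _]]] := lz; apply: (lang_infix HL) La; exact: infix_cons.
  suff : prefix z W by rewrite prefixE sz take_size => /eqP <-.
  apply: Wpre; rewrite ?sz //.
  rewrite -(Lspe (take q0 z)) ?prefix_take ?size_takel ?sz //.
  have [a [b [ab La Lb]]] := lz; exists a, b; split => //.
    apply: (lang_infix HL) La; rewrite -[_ :: take _ _]/(take q0.+1 (a :: z)).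
    exact: infix_take.
  apply: (lang_infix HL) Lb; rewrite -[_ :: take _ _]/(take q0.+1 (b :: z)).
  exact: infix_take.
have HBW l : size W <= l -> 2 * cplx L l < 3 * l by move=> Wl; apply: HB; lia.
have [LWc LWd] := (LW_R _ LRc, LW_R _ LRd).
have [u fu] := first_return_ex HL cd LWc.
have [v fv] := first_return_ex HL cd LWd.
have [uv|vu] := leqP (size (c :: u)) (size (d :: v)).
  do 4 eexists.
  exact: (state_loops HL cd LWc Wletter Wright Wleft fu fv erefl erefl uv HBW).
have dc : d != c by rewrite eq_sym.
have Wletter' e : L (rcons W e) -> e = d \/ e = c.
  by move=> /Wletter[]; [right|left].
do 4 eexists.
exact: (state_loops HL dc LWd Wletter' Wright Wleft fv fu erefl erefl (ltnW vu) HBW).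
Qed.

Local Open Scope classical_set_scope.

(** * The language of a minimal subshift *)

Section Windows.
Variable A : finType.
Implicit Types (x y : biseq A) (X : set (biseq A)).

Definition window x (N : nat) : set (biseq A) :=
  [set y | forall i : int, (absz i <= N)%N -> y i = x i].

Lemma nbhs_coord x (i : int) : nbhs x [set y : biseq A | y i = x i].
Proof.
have H := @proj_continuous int (fun _ => discrete_topology A) i x.
have : nbhs (proj i x) [set x i].
  by rewrite nbhs_principalE; apply/principal_filterP.
by move=> /H.
Qed.

Lemma nbhs_window x N : nbhs x (window x N).
Proof.
have FF : Filter (nbhs x) by exact: nbhs_filter.
elim: N => [|N IH].
  apply: filterS (nbhs_coord x 0%R) => y /= yx i.
  by rewrite leqn0 absz_eq0 => /eqP ->.
have H := filterI IH (filterI (nbhs_coord x (Posz N.+1)) (nbhs_coord x (Negz N))).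
apply: filterS (H FF FF) => y [/= yN [yP yM]] i iN.
have [iN'|Ni] := leqP `|i|%N N; first exact: yN.
by case: i iN Ni => n /= nN Nn;
  [have -> : n = N.+1 by lia | have -> : n = N by lia].
Qed.

(** Otherwise points outside [U], taken in ever larger windows, would converge to [x]
    coordinatewise. *)
Lemma window_basis x (U : set (biseq A)) : nbhs x U -> exists N, window x N `<=` U.
Proof.
move=> Ux; apply: contrapT => nN.
have /choice[y Hy] : forall N, exists y, window x N y /\ ~ U y.
  move=> N; apply: contrapT => ny; apply: nN; exists N => y yN.
  by apply: contrapT => nU; apply: ny; exists y.
have yx : y @ \oo --> x.
  apply/cvg_sup => i V [? [[W oW <-]] /= Wx /filterS]; apply.
  exists `|i|%N => // n /= ni.
  by rewrite (proj1 (Hy n)).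
have [n _ Un] : \forall n \near \oo, U (y n) by exact: yx.
by have := proj2 (Hy n); apply; apply: Un => /=.
Qed.

Lemma closed_window X x : closed X ->
  (forall N, exists2 y, X y & window x N y) -> X x.
Proof.
move=> cX H; apply: cX => U /window_basis[N NU].
by have [y Xy yN] := H N; exists y; split => //; exact: NU.
Qed.

Lemma window_closed X :
  (forall x, (forall N, exists2 y, X y & window x N y) -> X x) -> closed X.
Proof.
move=> H x cx; apply: H => N.
by have [y [Xy yN]] := cx _ (nbhs_window x N); exists y.
Qed.

Lemma biseq_compact : compact [set: biseq A].
Proof.
have cA : compact [set: discrete_topology A].
  by apply: finite_compact; exact: (@finite_finset A setT).
have H := @tychonoff int (fun _ => discrete_topology A) _ (fun _ => cA).
by rewrite (_ : setT = [set f : biseq A | forall i : int, setT (f i)]) //;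
  apply/seteqP; split.
Qed.

(** Cantor's intersection argument: each [Q N] depends on finitely many coordinates, so a cluster
    point inherits it. *)
Lemma window_compact X (Q : nat -> set (biseq A)) : closed X ->
  (forall M N, (N <= M)%N -> Q M `<=` Q N) ->
  (forall N, exists R, forall x y, Q N y -> window x R y -> Q N x) ->
  (forall N, exists2 x, X x & Q N x) -> exists2 x, X x & forall N, Q N x.
Proof.
move=> cX Qle Qwin /= XQ.
have /choice[f Hf] : forall N, exists x, X x /\ Q N x.
  by move=> N; have [x ? ?] := XQ N; exists x.
have XC : compact X by apply: subclosed_compact cX biseq_compact _.
have [|p [Xp cp]] := XC (f @ \oo) _.
  by exists 0%N => // n _; exact: (Hf n).1.
exists p => // N; have [R HR] := Qwin N.
have [|_ [[n Nn <-] fR]] := cp [set f n | n in [set n | (N <= n)%N]]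
    (window p R) _ (nbhs_window p R).
  by exists N => // n Nn; exists n.
by apply: HR fR; exact: Qle (Hf n).2.
Qed.

End Windows.

Import Order.TTheory GRing.Theory Num.Theory.

(** * Words and translates of bi-infinite sequences *)

Section Words.
Variable A : finType.
Implicit Types (x y : biseq A) (X : set (biseq A)) (w : seq A).

Definition word x (i : int) (n : nat) : seq A :=
  [seq x (i + j%:Z)%R | j <- iota 0 n].

Definition lang X w := exists2 x, X x & occurs w x.

Lemma size_word x i n : size (word x i n) = n.
Proof. by rewrite size_map size_iota. Qed.

Lemma nth_word a x i n j : (j < n)%N -> nth a (word x i n) j = x (i + j%:Z)%R.
Proof. by move=> jn; rewrite (nth_map 0%N) ?size_iota // nth_iota. Qed.

Lemma occurs_word x i n : occurs (word x i n) x.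
Proof. by exists i; rewrite size_word. Qed.

Lemma word_cat x i m n :
  word x i (m + n) = word x i m ++ word x (i + m%:Z)%R n.
Proof.
rewrite /word iotaD map_cat add0n; congr (_ ++ _).
rewrite -{1}[m]addn0 iotaDl -map_comp; apply: eq_map => j /=.
by congr x; lia.
Qed.

Lemma word_rcons x i n : word x i n.+1 = rcons (word x i n) (x (i + n%:Z)%R).
Proof.
rewrite -addn1 word_cat -cats1; congr (_ ++ [:: x _]); lia.
Qed.

Lemma word_cons x i n : word x i n.+1 = x i :: word x (i + 1)%R n.
Proof.
by rewrite -add1n word_cat; congr (x _ :: _); lia.
Qed.

Lemma occurs_infix x (s t : seq A) : infix s t -> occurs t x -> occurs s x.
Proof.
case/infixP => s1 [s2 ->] [i]; rewrite -/(word _ _ _) !size_cat !word_cat.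
move=> /eqP; rewrite eqseq_cat ?size_word // => /andP[_].
rewrite eqseq_cat ?size_word // => /andP[/eqP E _].
by exists (i + (size s1)%:Z)%R.
Qed.

Lemma infix_word x i n k m : (i <= k)%R -> (k + m%:Z <= i + n%:Z)%R ->
  infix (word x k m) (word x i n).
Proof.
move=> ik kn.
have -> : n = (`|(k - i)%R|%N + (m + (n - m - `|(k - i)%R|)))%N by lia.
rewrite !word_cat; have -> : (i + `|(k - i)%R|%N%:Z)%R = k by lia.
exact: infix_infix.
Qed.

Definition translate x (k : int) : biseq A := fun i => x (i + k)%R.

Lemma word_translate x k i n : word (translate x k) i n = word x (i + k)%R n.
Proof. by apply: eq_map => j; rewrite /translate; congr x; lia. Qed.

Section Subshift.
Variable X : set (biseq A).
Hypothesis sX : subshift X.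

Lemma shift_mem x : X x -> X (Defs.shift x).
Proof. by move=> Xx; rewrite -(proj2 sX); exists x. Qed.

Lemma translate_mem x k : X x -> X (translate x k).
Proof.
move=> Xx; have pos (y : biseq A) n : X y -> X (translate y n%:Z).
  move=> Xy; elim: n => [|n IH].
    by rewrite (_ : translate y 0 = y) //; apply/funext => i; rewrite /translate addr0.
  have := shift_mem IH; congr X; apply/funext => i.
  by rewrite /Defs.shift /translate; congr y; lia.
case: k => n; first exact: pos.
(* Backward translation uses the surjectivity of the shift on [X]. *)
have neg m : exists2 y, X y & x = translate y m%:Z.
  elim: m => [|m [y Xy Ey]].
    by exists x => //; apply/funext => i; rewrite /translate addr0.
  have : (@Defs.shift A @` X) y by rewrite (proj2 sX).
  case=> z Xz zy; exists z => //; rewrite Ey -zy; apply/funext => i.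
  by rewrite /translate /Defs.shift; congr z; lia.
have [y Xy ->] := neg n.+1.
rewrite (_ : translate _ _ = y) //; apply/funext => i.
by rewrite /translate; congr y; lia.
Qed.

Lemma lang_mem x : (forall w, occurs w x -> lang X w) -> X x.
Proof.
move=> H; apply: (closed_window (proj1 sX)) => N.
have [y Xy [i]] := H _ (occurs_word x (- N%:Z)%R (N + N).+1).
rewrite size_word -/(word _ _ _) => E.
exists (translate y (i + N%:Z)%R); first exact: translate_mem.
move=> k kN; pose j := `|(k + N%:Z)%R|%N.
have jN : (j < (N + N).+1)%N by rewrite /j; lia.
have := congr1 (nth (x k) ^~ j) E; rewrite /= !nth_word //.
have -> : (- N%:Z + j%:Z)%R = k by rewrite /j; lia.
by move=> ->; rewrite /translate; congr y; rewrite /j; lia.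
Qed.

End Subshift.

Section Minimal.
Variable X : set (biseq A).
Hypotheses (mX : minimal_subshift X) (iX : infinite_set X).

Let sX : subshift X. Proof. by case: mX. Qed.

(** A closed shift-invariant property true at one point of [X] cuts out a nonempty subshift, which
    is all of [X] by minimality. *)
Lemma minimal_forall (P : set (biseq A)) :
  (forall x, (forall N, exists2 y, P y & window x N y) -> P x) ->
  (forall x, P (Defs.shift x) <-> P x) ->
  (exists2 x, X x & P x) -> X `<=` P.
Proof.
move=> cP shP [x0 Xx0 Px0]; case: mX => _ _ Hmin.
suff <- : X `&` P = X by move=> x [].
apply: Hmin; [|by exists x0|by move=> x []].
split.
  apply: window_closed => x H; split.
    by apply: (closed_window (proj1 sX)) => N; have [y [Xy _] yN] := H N; exists y.
  by apply: cP => N; have [y [_ Py] yN] := H N; exists y.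
apply/seteqP; split=> [_ [x [Xx Px] <-]|y [Xy Py]].
  by split; [exact: shift_mem | apply/shP].
have : (@Defs.shift A @` X) y by rewrite (proj2 sX).
by case=> x Xx xy; exists x => //; split => //; apply/shP; rewrite xy.
Qed.

Definition periodic_word (a : A) (z : seq A) : biseq A :=
  fun i => nth a z `|(i %% (size z)%:Z)%Z|%N.

Lemma nth_pow a (z : seq A) j k : (k < j * size z)%N ->
  nth a (pow z j) k = nth a z (k %% size z)%N.
Proof.
elim: j k => [//|j IH] k; rewrite powS nth_cat mulSn.
case: (ltnP k (size z)) => [kz _|zk kj]; first by rewrite modn_small.
rewrite IH; last by lia.
by rewrite -[in RHS](subnK zk) modnDr.
Qed.

Lemma word_periodic a (z : seq A) i n : z != [::] ->
  exists j, infix (word (periodic_word a z) i n) (pow z j).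
Proof.
move=> z0; have sz : (0 < size z)%N by rewrite lt0n size_eq0.
pose r := `|(i %% (size z)%:Z)%Z|%N.
have rz : (r < size z)%N.
  have := ltz_pmod i (_ : 0 < (size z)%:Z)%R.
  have := modz_ge0 i (_ : (size z)%:Z != 0)%R.
  by rewrite /r; lia.
exists (n + 1)%N.
have nz : (n <= n * size z)%N by rewrite leq_pmulr.
have sp : size (pow z (n + 1)) = (n * size z + size z)%N.
  by rewrite size_pow mulnDl mul1n.
suff -> : word (periodic_word a z) i n = take n (drop r (pow z (n + 1))).
  by apply: infix_trans (infix_take _ _) (infix_drop _ _).
apply: (@eq_from_nth _ a).
  by rewrite size_word size_takel // size_drop sp; lia.
move=> j; rewrite size_word => jn.
rewrite nth_word // nth_take // nth_drop nth_pow; last first.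
  by rewrite mulnDl mul1n; lia.
rewrite /periodic_word; congr nth.
rewrite -modzDml; have -> : (i %% (size z)%:Z)%Z = Posz r.
  rewrite /r gez0_abs // modz_ge0 //; lia.
by rewrite -PoszD modz_nat.
Qed.

(** If all powers of [z] occurred, [X] would contain the periodic point of [z]; by minimality every
    point would have period [size z], and [X] would be finite. *)
Lemma lang_aperiodic (z : seq A) : z != [::] -> exists j, ~ lang X (pow z j).
Proof.
move=> z0; apply: contrapT => nj; apply: iX.
have sz : (0 < size z)%N by rewrite lt0n size_eq0.
have Lj j : lang X (pow z j).
  by apply: contrapT => n; apply: nj; exists j.
have [a _] : exists a, a \in z by case: (z) z0 => // a s _; exists a; rewrite mem_head.
have XP : X `<=` [set x | forall i, x (i + (size z)%:Z)%R = x i].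
  apply: minimal_forall.
  - move=> x H i; have [y Py yx] := H (`|i| + size z)%N.
    by have := Py i; rewrite !yx //; lia.
  - move=> x; split => Px i; last first.
      by rewrite /Defs.shift -(Px (i + 1)%R); congr x; lia.
    have := Px (i - 1)%R; rewrite /Defs.shift => E.
    transitivity (x (i - 1 + (size z)%:Z + 1)%R); first by congr x; lia.
    by rewrite E; congr x; lia.
  - exists (periodic_word a z); last first.
      by move=> i; rewrite /periodic_word modzDr.
    apply: (lang_mem sX) => w [i E].
    have [j Hj] := word_periodic a i (size w) z0.
    have [x Xx oc] := Lj j; exists x => //.
    by apply: occurs_infix oc; rewrite E.
pose f (t : (size z).-tuple A) : biseq A := periodic_word a t.
apply: (@sub_finite_set _ _ (f @` setT)); last exact/finite_image/finite_finset.
move=> x /XP Px.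
have Pk (k : nat) i : x (i + k%:Z * (size z)%:Z)%R = x i.
  elim: k => [|k IH]; first by rewrite mul0r addr0.
  by rewrite -[RHS]IH -[RHS]Px; congr x; lia.
have Pz (k : int) i : x (i + k * (size z)%:Z)%R = x i.
  case: k => k; first exact: Pk.
  by rewrite -[LHS](Pk k.+1); congr x; lia.
have st : size (word x 0 (size z)) == size z by rewrite size_word.
exists (Tuple st) => //; apply/funext => i.
rewrite /f /periodic_word /= size_word.
have m0 : (0 <= (i %% (size z)%:Z)%Z)%R by rewrite modz_ge0 //; lia.
have mz : ((i %% (size z)%:Z)%Z < (size z)%:Z)%R by rewrite ltz_pmod.
rewrite nth_word; last by lia.
rewrite add0r gez0_abs // -(Pz (i %/ (size z)%:Z)%Z); congr x.
by rewrite addrC -divz_eq.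
Qed.

(** Arbitrarily long words without [w], recentred at the origin, yield by compactness a point
    without [w], and by minimality no point contains [w]. *)
Lemma lang_recurrent w : lang X w ->
  exists N, forall t, lang X t -> (N <= size t)%N -> infix w t.
Proof.
move=> [x0 Xx0 [i0 E0]]; apply: contrapT => nN.
pose Q N : set (biseq A) := [set x |
  forall i : int, (absz i <= N)%N -> word x i (size w) <> w].
have [|||x Xx Qx] := @window_compact A X Q (proj1 sX).
- by move=> M N NM x Qx i iN; apply: Qx; exact: leq_trans NM.
- move=> N; exists (N + size w)%N => x y Qy yx i iN E; apply: (Qy i iN).
  rewrite -[RHS]E; apply/eq_in_map => j; rewrite mem_iota => jw.
  by apply: yx; lia.
- move=> N; have [t [[y Xy [i E]] sN nw]] : exists t,
      [/\ lang X t, (N + N + size w <= size t)%N & ~ infix w t].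
    apply: contrapT => nt; apply: nN; exists (N + N + size w)%N => t Lt st.
    by apply: contrapT => nw; apply: nt; exists t.
  exists (translate y (i + N%:Z)%R); first exact: translate_mem.
  move=> k kN; rewrite word_translate => Ew; apply: nw.
  rewrite -Ew E -/(word _ _ _); apply: infix_word; lia.
have : X `<=` [set x | forall i : int, word x i (size w) <> w].
  apply: minimal_forall.
  - move=> y H i E; have [v Pv vy] := H (`|i| + size w)%N.
    apply: (Pv i); rewrite -[RHS]E; apply/eq_in_map => j; rewrite mem_iota => jw.
    by apply: vy; lia.
  - have sh y i n : word (Defs.shift y) i n = word y (i + 1)%R n.
      by apply: eq_map => j; rewrite /Defs.shift; congr y; lia.
    move=> y; split => Py i; last by rewrite sh.
    by have := Py (i - 1)%R; rewrite sh subrK.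
  - by exists x => // i; apply: (Qx `|i|%N).
by move=> /(_ _ Xx0)/(_ i0); apply.
Qed.

Lemma minimal_language : language (lang X).
Proof.
split.
- by have [_ [x Xx] _] := mX; exists x => //; exists 0%R.
- by move=> s t st [x Xx ox]; exists x => //; exact: occurs_infix ox.
- move=> w [x Xx [i E]]; exists (x (i + (size w)%:Z)%R); exists x => //.
  by rewrite [in rcons w]E -/(word _ _ _) -word_rcons; exact: occurs_word.
- move=> w [x Xx [i E]]; exists (x (i - 1)%R); exists x => //.
  have -> : x (i - 1)%R :: w = word x (i - 1)%R (size w).+1.
    by rewrite word_cons subrK [in LHS]E.
  exact: occurs_word.
- exact: lang_aperiodic.
- exact: lang_recurrent.
Qed.

End Minimal.
End Words.

(** * The limit sequence *)

Lemma limn_esup_ratio_lt (R : realType) (p : nat -> nat) :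
  (limn_esup (fun q : nat => ((p q)%:R / q%:R : R)%R%:E) < (3 / 2 : R)%R%:E)%E ->
  exists N, forall q, (N <= q)%N -> (2 * p q < 3 * q)%N.
Proof.
move=> /ereal_inf_lt[_ [V [N _ NV] <-] supV].
(* The successor guarantees [0 < q], needed to clear the denominator. *)
exists N.+1 => q Nq.
have : ((((p q)%:R / q%:R : R)%R)%:E < (3 / 2 : R)%R%:E)%E.
  apply: le_lt_trans supV; apply: ereal_sup_ubound; exists q => //.
  by apply: NV => /=; exact: ltnW.
have q0 : (0 < q%:R :> R)%R by rewrite ltr0n; lia.
rewrite lte_fin ltr_pdivrMr // mulrAC ltr_pdivlMr ?ltr0n // -!natrM ltr_nat.
by rewrite mulnC.
Qed.

Section SuffixLimit.
Variables (A : finType) (U : nat -> seq A).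
Hypothesis Usuf : forall k, suffix (U k) (U k.+1).
Hypothesis Usize : forall k, (k < size (U k))%N.

Lemma suffix_chain i k : (i <= k)%N -> suffix (U i) (U k).
Proof.
move=> /subnKC <-; elim: (k - i)%N => [|n IH]; first by rewrite addn0 suffix_refl.
by rewrite addnS; apply: suffix_trans IH (Usuf _).
Qed.

Lemma suffix_limit_ex : exists y : nat -> A, left_limit U y /\
  forall w, left_occurs w y <-> exists k, infix w (U k).
Proof.
have [a _] : exists a, a \in U 0.
  by case: (U 0) (Usize 0) => // a s _; exists a; rewrite mem_head.
(* [U i] has more than [i] letters, so the default [a] is never read, and all later words agree at
   this place. *)
pose y i := nth a (rev (U i)) i; exists y.
have yE i k : (i <= k)%N -> nth a (rev (U k)) i = y i.
  move=> /suffix_chain; rewrite -prefix_rev => /prefixP[s ->].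
  by rewrite nth_cat size_rev Usize.
have yseq i k n : (i + n <= k.+1)%N ->
    [seq y (i + j) | j <- iota 0 n] = take n (drop i (rev (U k))).
  move=> ink; have sU := Usize k; apply: (@eq_from_nth _ a).
    rewrite size_map size_iota size_takel // size_drop size_rev leq_subRL.
      exact: leq_trans ink sU.
    exact: leq_trans (leq_addr n i) (leq_trans ink sU).
  move=> j; rewrite size_map size_iota => jn.
  rewrite (nth_map 0) ?size_iota // nth_iota // add0n nth_take // nth_drop.
  by rewrite yE //; lia.
split.
  move=> i; exists i => // k /= ik.
  have := onthTE (rev (U k)) i; rewrite size_rev (leq_ltn_trans ik (Usize k)).
  case E: (onth _ _) => [b|] // _.
  by rewrite -(onth_nth a _ _ _ E) yE.
move=> w; split.
  case=> i E; exists (i + size w)%N; rewrite -infix_rev E.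
  rewrite (@yseq _ (i + size w)) //.
  by apply: infix_trans (infix_take _ _) (infix_drop _ _).
case=> k wk; have [s [t E]] : exists s t : seq A, U k = s ++ w ++ t by apply/infixP.
exists (size t).
(* An index large enough for the whole segment to be read, and at least [k], so that [U k] is a
   suffix. *)
rewrite (@yseq _ (size (U k) + k)).
  have /suffixP[r Er] : suffix (U k) (U (size (U k) + k)).
    by apply: suffix_chain; exact: leq_addl.
  rewrite Er E !catA !rev_cat drop_size_cat ?size_rev //.
  by rewrite take_size_cat ?size_rev.
by rewrite E !size_cat; lia.
Qed.

End SuffixLimit.

Lemma tau_false_suffix m n r : suffix [:: true] (tau m n r false).
Proof.
by case: r => [|r]; rewrite /= ?catA -?(cat1s true (_ ++ _)) ?catA suffix_suffix.
Qed.

Lemma tau_true m n r :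
  tau m n r true = nseq (n - m) false ++ tau m n r false.
Proof. by case: r. Qed.

Lemma size_subst_ext (A B : eqType) (s : substitution A B) w :
  nonerasing s -> (size w <= size (subst_ext s w))%N.
Proof.
move=> ns; elim: w => // a w IH; rewrite subst_ext_cons size_cat /= -add1n.
by apply: leq_add => //; rewrite lt0n size_eq0; apply/eqP/ns.
Qed.

Theorem corollary3p3 (R : realType) (A : finType) (X : set (biseq A)) :
  infinite_set X ->
  minimal_subshift X ->
  (limn_esup (fun q : nat => ((complexity X q)%:R / q%:R : R)%R%:E)
     < (3 / 2 : R)%R%:E)%E ->
  exists m n r : nat -> nat,
    (forall k, r k < m k < n k)%N /\
    exists pi : substitution bool A,
      nonerasing pi /\
      exists y : nat -> A,
        left_limit (fun k => subst_comp pi (tau_prod m n r k) false) y /\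
        X = left_orbit_closure y.
Proof.
move=> iX mX /limn_esup_ratio_lt[N HN].
have HL := minimal_language mX iX.
have [S0 [P0 [pi [D0 HS]]]] := initial_state HL HN.
have [m [n [r [mnr steps]]]] := tau_steps HL HS.
exists m, n, r; split => //; exists pi.
have nonerasing_coding S P (p : substitution bool A) :
    coding (lang X) S P p -> nonerasing p.
  by move=> HC b; apply/eqP; exact: (coding_nonerasing HC).
have npi : nonerasing pi by exact: (nonerasing_coding _ _ _ (st_cod HS)).
split => //.
pose p k : substitution bool A := subst_comp pi (tau_prod m n r k).
have np k : nonerasing (p k).
  have [S [P [D Hk]]] := steps k.
  exact: (nonerasing_coding _ _ _ (st_cod Hk)).
(* The nonempty prefix [t], coming from [n k - m k > 0] zeros, makes the lengths in [Usize] grow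
   strictly. *)
have p_true k : exists2 t, t != [::] & p k true = t ++ p k false.
  have [q nq pE] : exists2 q : substitution bool A, nonerasing q &
      p k = subst_comp q (tau (m k) (n k) (r k)).
    by case: k => [|k]; [exists pi | exists (p k) => //; exact: subst_compA].
  exists (subst_ext q (nseq (n k - m k) false)).
    rewrite -size_eq0 -lt0n; apply: leq_trans (size_subst_ext _ nq).
    by rewrite size_nseq subn_gt0; have /andP[] := mnr k.
  by rewrite pE /subst_comp tau_true subst_ext_cat.
have p_suf k : suffix (p k true) (p k.+1 false).
  have -> : p k.+1 = subst_comp (p k) (tau (m k.+1) (n k.+1) (r k.+1)).
    exact: subst_compA.
  have /suffixP[s E] := tau_false_suffix (m k.+1) (n k.+1) (r k.+1).
  by rewrite /subst_comp E subst_ext_cat subst_ext1 suffix_suffix.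
have Usuf k : suffix (p k false) (p k.+1 false).
  have [t _ E] := p_true k; apply: suffix_trans (p_suf k).
  by rewrite E suffix_suffix.
have Usize k : (k < size (p k false))%N.
  elim: k => [|k IH]; first by rewrite lt0n size_eq0; apply/eqP/np.
  have [t t0 E] := p_true k; apply: leq_trans (size_suffix (p_suf k)).
  rewrite E size_cat -add1n leq_add // lt0n size_eq0 //.
have LU k : lang X (p k false).
  have [S [P [D Hk]]] := steps k.
  have := coded_letter HL Hk false; rewrite /frame subst_ext1; exact: (lang_mid HL).
have [y [ylim yocc]] := suffix_limit_ex Usuf Usize.
exists y; split => //; apply/seteqP; split => [x Xx w ow|x Hx].
  (* The recurrence bound [M] also serves as index, since [p M false] has more than [M] letters. *)
  have [M HM] := lang_recur HL (ex_intro2 _ _ x Xx ow : lang X w).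
  apply/yocc; exists M; apply: HM (LU M) _; exact: ltnW.
apply: lang_mem => [|w /Hx /yocc[k wk]]; first by case: mX.
exact: (lang_infix HL) wk (LU k).
Qed.
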